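(* Let $(M,\bar g,u)$ be a complete, non-Einstein, expanding gradient Ricci soliton of cohomogeneity one with a special orbit, with soliton constant $\epsilon>0$. Suppose $t_1>2\sqrt{\frac{5}{\epsilon}}$ and that on $[t_1,+\infty)$ we have an upper bound $\lambda_0>0$ for $\mathrm{tr}\,L$. Set $a:=\lambda_0+\sqrt{-C}$. Then on $[t_1,+\infty)$ we have: (i) $$|\overline{\nabla}u|=-\dot u(t)>\frac{9}{10}\left(\frac{-\dot u(t_1)}{\frac{\epsilon}{2}t_1+a}\right)\left(\frac{\epsilon}{2}t+a\right);$$ (ii) $$\ddot u+\frac{\epsilon}{2}=-\mathrm{Ric}_{\bar g}\left(\frac{\partial}{\partial t},\frac{\partial}{\partial t}\right)\le\frac{\epsilon}{2}\left(1+\frac{9}{10}\,\frac{\dot u(t_1)}{\frac{\epsilon}{2}t_1+a}\right).$$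
   Context: An expanding gradient Ricci soliton is $(M,\bar g,u)$, with $\bar g$ a smooth Riemannian metric and $u$ a smooth function, satisfying $\mathrm{Ric}(\bar g)+\mathrm{Hess}(u)+\frac{\epsilon}{2}\bar g=0$ for a constant $\epsilon>0$. It is complete if $\bar g$ is complete, and non-Einstein if $\bar g$ is not an Einstein metric. ''Cohomogeneity one with a special orbit'' refers to the following setting. $M$ is noncompact of dimension $n+1$. There is a compact submanifold of $M$ (the special orbit) such that, with $t\in[0,\infty)$ the distance from it, the complement is identified with $(0,\infty)\times P$ with $P$ a compact $n$-manifold, and $\bar g=dt^2+g_t$ there, where $g_t$ is a metric on the hypersurface $P_t=\{t\}\times P$. As $t\to0$ the hypersurfaces collapse smoothly onto the special orbit, which is placed at $t=0$, with collapsing spheres of dimension $k\ge1$ (so the special orbit has codimension $k+1$). The potential $u$ is a function of $t$ only. The scalar curvature $S$ of $g_t$ and the mean curvature $\mathrm{tr}\,L$ of $P_t$ with respect to $\partial/\partial t$ are constant on each $P_t$; here $L=L_t$ is the shape operator, defined by $\dot g_t=2g_tL_t$. This holds for instance if a compact Lie group acts isometrically with principal orbits $P_t$ and preserves $u$. The potential is normalized by $u(0)=0$. A dot denotes $d/dt$, and $\overline{\nabla}$ is the Levi-Civita connection of $\bar g$. $C$ is the constant in the conservation law $\ddot u+(-\dot u+\mathrm{tr}\,L)\dot u-\epsilon u=C$, which holds along the soliton. With $u(0)=0$ the smoothness conditions at $t=0$ give $C=(k+1)\ddot u(0)$, and $C<0$ for complete non-Einstein expanders. *)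

(* Defs.v *)
From mathcomp Require Import all_boot all_order all_algebra.
From mathcomp Require Import all_classical all_reals all_analysis.

Set Implicit Arguments.
Unset Strict Implicit.
Unset Printing Implicit Defensive.

Import Order.TTheory GRing.Theory Num.Theory.
Import numFieldNormedType.Exports.

Local Open Scope ring_scope.
Local Open Scope classical_set_scope.

Definition partial (R : realType) (m : nat) (W : normedModType R) (i : 'I_m)
    (f : 'rV[R]_m -> W) : 'rV[R]_m -> W :=
  fun x => 'D_(delta_mx 0 i) f x.

Fixpoint times_differentiable (R : realType) (m : nat) (W : normedModType R)
    (r : nat) (A : set 'rV[R]_m) (f : 'rV[R]_m -> W) : Prop :=
  match r with
  | 0 => True
  | r'.+1 => (forall x, A x -> differentiable f x) /\
             (forall i : 'I_m, times_differentiable r' A (partial i f))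
  end.

(** Infinite differentiability; [A] is always an open set. *)
Definition smooth_on (R : realType) (m : nat) (W : normedModType R)
    (A : set 'rV[R]_m) (f : 'rV[R]_m -> W) : Prop :=
  forall r, times_differentiable r A f.

(** Below, [G] is the Gram matrix [(g_ij)] of a metric, as a function of the
    coordinates; vectors are rows of components. *)

Definition inner (R : realType) (m : nat) (A : 'M[R]_m) (v w : 'rV[R]_m) : R :=
  (v *m A *m w^T) 0 0.

Definition vnorm (R : realType) (m : nat) (A : 'M[R]_m) (v : 'rV[R]_m) : R :=
  Num.sqrt (inner A v v).

(** [christoffel G k i j] is [Gamma^k_ij]. *)
Definition christoffel (R : realType) (m : nat) (G : 'rV[R]_m -> 'M[R]_m)
    (k i j : 'I_m) (x : 'rV[R]_m) : R :=
  2^-1 * \sum_l (invmx (G x) k l *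
    (partial i (fun y => G y j l) x + partial j (fun y => G y i l) x
     - partial l (fun y => G y i j) x)).

(** Sign convention: round spheres have positive Ricci curvature. *)
Definition ricci (R : realType) (m : nat) (G : 'rV[R]_m -> 'M[R]_m)
    (x : 'rV[R]_m) : 'M[R]_m :=
  \matrix_(i, j)
    (\sum_k partial k (christoffel G k i j) x
     - \sum_k partial j (christoffel G k k i) x
     + \sum_k \sum_l (christoffel G k k l x * christoffel G l i j x
                      - christoffel G k j l x * christoffel G l k i x)).

Definition scalar_curvature (R : realType) (m : nat)
    (G : 'rV[R]_m -> 'M[R]_m) (x : 'rV[R]_m) : R :=
  \tr (invmx (G x) *m ricci G x).

Definition hessian (R : realType) (m : nat) (G : 'rV[R]_m -> 'M[R]_m)
    (f : 'rV[R]_m -> R) (x : 'rV[R]_m) : 'M[R]_m :=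
  \matrix_(i, j) (partial i (partial j f) x
                  - \sum_k christoffel G k i j x * partial k f x).

Definition gradient (R : realType) (m : nat) (G : 'rV[R]_m -> 'M[R]_m)
    (f : 'rV[R]_m -> R) (x : 'rV[R]_m) : 'rV[R]_m :=
  (\row_i partial i f x) *m invmx (G x).

(** [crd : cdom -> ccod] and [par : ccod -> cdom] are mutually inverse; the
    values of [crd] and [par] elsewhere are irrelevant. *)
Record chart (R : realType) (m : nat) (M : topologicalType) := Chart {
  cdom : set M;
  ccod : set 'rV[R]_m;
  crd : M -> 'rV[R]_m;
  par : 'rV[R]_m -> M }.

Definition is_chart (R : realType) (m : nat) (M : topologicalType)
    (c : chart R m M) : Prop :=
  [/\ open (cdom c) /\ open (ccod c),
      forall x, cdom c x -> ccod c (crd c x) /\ par c (crd c x) = x,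
      forall y, ccod c y -> cdom c (par c y) /\ crd c (par c y) = y,
      forall x, cdom c x -> {for x, continuous (crd c)}
    & forall y, ccod c y -> {for y, continuous (par c)}].

Definition transition (R : realType) (m : nat) (M : topologicalType)
    (c c' : chart R m M) : 'rV[R]_m -> 'rV[R]_m :=
  fun y => crd c' (par c y).

Definition compatible (R : realType) (m : nat) (M : topologicalType)
    (c c' : chart R m M) : Prop :=
  smooth_on (crd c @` (cdom c `&` cdom c')) (transition c c').

(** A smooth structure is a maximal smooth atlas; [chart_at] selects a chart
    around each point. *)
Record smooth_manifold (R : realType) (m : nat) (M : topologicalType) :=
  SmoothManifold {
  manifold_hausdorff : hausdorff_space M;
  manifold_second_countable : @second_countable M;
  atlas : set (chart R m M);
  chart_at : M -> chart R m M;
  atlas_chart : forall c, atlas c -> is_chart c;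
  chart_atP : forall x, atlas (chart_at x) /\ cdom (chart_at x) x;
  atlas_compatible : forall c c', atlas c -> atlas c' -> compatible c c';
  atlas_maximal : forall c, is_chart c ->
    (forall c', atlas c' -> compatible c c' /\ compatible c' c) -> atlas c }.

Definition smooth_function (R : realType) (m : nat) (M : topologicalType)
    (S : smooth_manifold R m M) (u : M -> R) : Prop :=
  forall c, atlas S c -> smooth_on (ccod c) (u \o par c).

Record metric (R : realType) (m : nat) (M : topologicalType)
    (S : smooth_manifold R m M) := Metric {
  gram : chart R m M -> 'rV[R]_m -> 'M[R]_m;
  gram_smooth : forall c, atlas S c -> smooth_on (ccod c) (gram c);
  gram_sym : forall c y, atlas S c -> ccod c y -> (gram c y)^T = gram c y;
  gram_pos : forall c y v, atlas S c -> ccod c y -> v != 0 ->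
    0 < inner (gram c y) v v;
  gram_change : forall c c' x, atlas S c -> atlas S c' ->
    cdom c x -> cdom c' x ->
    let J := jacobian (transition c c') (crd c x) in
    gram c (crd c x) = J *m gram c' (crd c' x) *m J^T }.

Definition velocity (R : realType) (m : nat) (M : topologicalType)
    (c : chart R m M) (gam : R -> M) (s : R) : 'rV[R]_m :=
  derive1 (crd c \o gam) s.

Definition C1_at (R : realType) (m : nat) (M : topologicalType)
    (S : smooth_manifold R m M) (gam : R -> M) (s : R) : Prop :=
  {for s, continuous gam} /\
  forall c, atlas S c -> cdom c (gam s) ->
    (\forall r \near s, derivable (crd c \o gam) r 1) /\
    {for s, continuous (velocity c gam)}.

Definition speed (R : realType) (m : nat) (M : topologicalType)
    (S : smooth_manifold R m M) (g : metric S) (gam : R -> M) (s : R) : R :=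
  let c := chart_at S (gam s) in
  vnorm (gram g c (crd c (gam s))) (velocity c gam s).

Definition curve_length (R : realType) (m : nat) (M : topologicalType)
    (S : smooth_manifold R m M) (g : metric S) (gam : R -> M) : \bar R :=
  (\int[lebesgue_measure]_(s in `[0%R, 1%R]) (speed g gam s)%:E)%E.

(** Restricting to curves that are C^1 near [0, 1] gives the same infimum as
    piecewise C^1 curves: the latter become C^1 after a reparametrization that
    stops at the corners and at the end points. *)
Definition riem_dist (R : realType) (m : nat) (M : topologicalType)
    (S : smooth_manifold R m M) (g : metric S) (x y : M) : \bar R :=
  ereal_inf [set curve_length g gam | gam in
    [set gam : R -> M | [/\ forall s, 0 <= s <= 1 -> C1_at S gam s,
                            gam 0 = x & gam 1 = y]]].

Definition dist_to (R : realType) (m : nat) (M : topologicalType)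
    (S : smooth_manifold R m M) (g : metric S) (Q : set M) (x : M) : \bar R :=
  ereal_inf [set riem_dist g q x | q in Q].

Definition complete_metric (R : realType) (m : nat) (M : topologicalType)
    (S : smooth_manifold R m M) (g : metric S) : Prop :=
  forall s : nat -> M,
    (forall e : R, 0 < e -> exists N, forall i j, (N <= i)%N -> (N <= j)%N ->
       (riem_dist g (s i) (s j) < e%:E)%E) ->
    exists x, forall e : R, 0 < e -> exists N, forall i, (N <= i)%N ->
       (riem_dist g (s i) x < e%:E)%E.

Definition einstein (R : realType) (m : nat) (M : topologicalType)
    (S : smooth_manifold R m M) (g : metric S) : Prop :=
  exists lam : R, forall c y, atlas S c -> ccod c y ->
    ricci (gram g c) y = lam *: gram g c y.

Definition expanding_soliton (R : realType) (m : nat) (M : topologicalType)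
    (S : smooth_manifold R m M) (g : metric S) (u : M -> R) (eps : R) : Prop :=
  [/\ 0 < eps, smooth_function S u &
      forall c y, atlas S c -> ccod c y ->
        ricci (gram g c) y + hessian (gram g c) (u \o par c) y
        + (eps / 2) *: gram g c y = 0].

(** [grad_norm] and [ricci_at] do not depend on the chart [c] around [x], the
    components [v], [w] being taken in [c]. *)

Definition grad_norm (R : realType) (m : nat) (M : topologicalType)
    (S : smooth_manifold R m M) (g : metric S) (u : M -> R)
    (c : chart R m M) (x : M) : R :=
  vnorm (gram g c (crd c x)) (gradient (gram g c) (u \o par c) (crd c x)).

Definition ricci_at (R : realType) (m : nat) (M : topologicalType)
    (S : smooth_manifold R m M) (g : metric S)
    (c : chart R m M) (x : M) (v w : 'rV[R]_m) : R :=
  inner (ricci (gram g c) (crd c x)) v w.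

Definition submanifold (R : realType) (m : nat) (M : topologicalType)
    (S : smooth_manifold R m M) (codim : nat) (Q : set M) : Prop :=
  (codim <= m)%N /\
  forall q, Q q -> exists c, [/\ atlas S c, cdom c q &
    forall x, cdom c x ->
      (Q x <-> forall i : 'I_m, (i < codim)%N -> crd c x 0 i = 0)].

(** The shape operator of a family [h] of metrics on [P], in a chart of [P]:
    the solution [L] of [d/dt h_t = 2 h_t L]. *)
Definition shape_operator (R : realType) (n : nat) (P : topologicalType)
    (SP : smooth_manifold R n P) (h : R -> metric SP) (c : chart R n P)
    (t : R) (y : 'rV[R]_n) : 'M[R]_n :=
  2^-1 *: (invmx (gram (h t) c y) *m derive1 (fun s => gram (h s) c y) t).

(** [c] is the chart [(t, c')] of [M] in which [tube] becomes the identity. *)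
Definition product_chart (R : realType) (n : nat) (M P : topologicalType)
    (tube : R -> P -> M) (c' : chart R n P) (c : chart R n.+1 M) : Prop :=
  cdom c = [set x | exists (t : R) p, [/\ 0 < t, cdom c' p & x = tube t p]] /\
  (forall (t : R) p, 0 < t -> cdom c' p ->
     crd c (tube t p) = row_mx (t%:M : 'M[R]_(1, 1)) (crd c' p)).

(** [tube] is the identification of [(0, oo) x P] with the complement of the
    special orbit: by [tube_chart], a diffeomorphism for the product structure.
    The values of [tube], [hyper], [mean_curv], [scal] at [t <= 0] and of
    [profile] at [t < 0] are irrelevant.  The smooth collapse of the
    hypersurfaces onto the special orbit, with [k]-spheres as fibres, is encoded
    by [orbit] being a submanifold of codimension [k + 1] in the manifold [M]
    across which the metric and [u] are smooth, with [t] the distance to it. *)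
Record cohomogeneity_one (R : realType) (n k : nat) (M P : topologicalType)
    (SM : smooth_manifold R n.+1 M) (SP : smooth_manifold R n P)
    (g : metric SM) (u : M -> R) := CohomogeneityOne {
  M_noncompact : ~ compact [set: M];
  P_compact : compact [set: P];
  sphere_dim : (1 <= k)%N;
  orbit : set M;
  orbit_compact : compact orbit;
  orbit_submanifold : submanifold SM k.+1 orbit;
  tube : R -> P -> M;
  tube_inj : forall (t t' : R) p p', 0 < t -> 0 < t' -> tube t p = tube t' p' ->
    t = t' /\ p = p';
  tube_image : forall x, ~ orbit x <-> exists (t : R) p, 0 < t /\ x = tube t p;
  tube_chart : forall c', atlas SP c' ->
    exists c, atlas SM c /\ product_chart tube c' c;
  tube_dist : forall (t : R) p, 0 < t -> dist_to g orbit (tube t p) = t%:E;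
  hyper : R -> metric SP;
  metric_form : forall c' c (t : R) y, atlas SP c' -> atlas SM c ->
    product_chart tube c' c -> 0 < t -> ccod c' y ->
    gram g c (row_mx (t%:M : 'M[R]_(1, 1)) y)
    = block_mx (1%:M : 'M[R]_(1, 1)) 0 0 (gram (hyper t) c' y);
  profile : R -> R;
  profile_tube : forall (t : R) p, 0 < t -> u (tube t p) = profile t;
  profile_orbit : forall x, orbit x -> u x = profile 0;
  mean_curv : R -> R;
  mean_curvP : forall (t : R) c' y, 0 < t -> atlas SP c' -> ccod c' y ->
    \tr (shape_operator hyper c' t y) = mean_curv t;
  scal : R -> R;
  scalP : forall (t : R) c' y, 0 < t -> atlas SP c' -> ccod c' y ->
    scalar_curvature (gram (hyper t) c') y = scal t }.

Definition conservation_law (R : realType) (n k : nat) (M P : topologicalType)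
    (SM : smooth_manifold R n.+1 M) (SP : smooth_manifold R n P)
    (g : metric SM) (u : M -> R) (D : cohomogeneity_one k SP g u)
    (eps C : R) : Prop :=
  forall t, 0 < t ->
    derive1n 2 (profile D) t
    + (- derive1 (profile D) t + mean_curv D t) * derive1 (profile D) t
    - eps * profile D t = C.

(* Main.v *)
Require Import Defs.
From mathcomp Require Import all_boot all_order all_algebra.
From mathcomp Require Import all_classical all_reals all_analysis.
From mathcomp Require Import ring lra.
Set Implicit Arguments.
Unset Strict Implicit.
Unset Printing Implicit Defensive.
Import Order.TTheory GRing.Theory Num.Theory.
Import numFieldNormedType.Exports.
Local Open Scope ring_scope.
Local Open Scope classical_set_scope.

(** Write [h = eps / 2], [y = - u'], [E = - C - eps u] and [xi = tr L - u'], as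
    functions of the distance [t > 0] from the special orbit.  The conservation law
    reads [y' = E - xi y], with [E' = 2 h y]; the normal component of the soliton
    equation is the traced Riccati equation [xi' = h - tr (L ^ 2)], where
    [tr (L ^ 2)] dominates a multiple of [(tr L) ^ 2] ([traced_riccati]).  The
    theorem is a statement about solutions of this system on the half line.

    The initial conditions at the special orbit are [u = 0] and [u' = 0].  A ray in
    a chart that leaves the orbit meets every hypersurface close to the orbit,
    because distances along it are at most proportional to the parameter
    ([ray_meets_hypersurfaces]); so the limits of [u] and of [|grad u|] can be
    computed along the ray.  The gradient of [u] vanishes on the orbit, for
    otherwise [u] would have both signs on each nearby hypersurface.

    The sign of [C] comes from the Laplacian [F = y ^ 2 - E] of [u].  It satisfies
    [F'' + xi F' >= 2 h F + kappa F ^ 2], and [xi] grows at most linearly, so a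
    positive and increasing [F] would blow up in finite time ([quadratic_blowup]).
    This excludes [C > 0]; [C = 0] forces [u = 0], an Einstein metric; and for
    [C < 0] it gives [y > 0] and [y ^ 2 <= E], hence [y <= sqrt (- C) + h t]
    ([y_le_affine]) and [xi <= h t + a] on [[t1, oo)].

    The main point is [h y <= max (xi, h t) y'] at every time
    ([log_derivative_ge]).  As [xi' <= h], the past of [xi] lies above a line of
    slope [h]; the Riccati equation of [E / y = y' / y + xi] is monotone in [xi], so
    the linear case, which has an explicit solution, is extremal.  With
    [w = h t + a] this gives [h y <= w y'] on [[t1, oo)], so [y / w] does not
    decrease and [y' >= h y / w >= h y(t1) / w(t1)].  Both estimates follow, even
    with the factor 1 in place of 9/10, which makes the first one strict.

    The remaining work is to pass between charts: the norm of the gradient and the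
    Ricci curvature in the direction of [d/dt] are computed in an arbitrary chart
    by differentiating [u] and the unit speed of the normal curve along that curve
    ([hessian_along]). *)

(** * Calculus on the line *)

Section Calculus.
Context {R : realType}.
Implicit Types f df : R -> R.

Lemma is_derive_continuous f (x d : R) :
  is_derive x 1 f d -> {for x, continuous f}.
Proof.
by move=> fx; apply/differentiable_continuous/derivable1_diffP/ex_derive.
Qed.

Lemma is_derive1D f g (x a b : R) : is_derive x 1 f a -> is_derive x 1 g b ->
  is_derive x 1 (fun s => f s + g s) (a + b).
Proof. by move=> fx gx; exact: is_deriveD. Qed.

Lemma is_derive1B f g (x a b : R) : is_derive x 1 f a -> is_derive x 1 g b ->
  is_derive x 1 (fun s => f s - g s) (a - b).
Proof. by move=> fx gx; exact: is_deriveB. Qed.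

Lemma is_derive1N f (x a : R) : is_derive x 1 f a ->
  is_derive x 1 (fun s => - f s) (- a).
Proof. by move=> fx; exact: is_deriveN. Qed.

Lemma is_derive1M f g (x a b : R) : is_derive x 1 f a -> is_derive x 1 g b ->
  is_derive x 1 (fun s => f s * g s) (a * g x + f x * b).
Proof.
move=> fx gx; have := is_deriveM fx gx; rewrite /GRing.scale/=.
by rewrite addrC [g x * a]mulrC.
Qed.

Lemma is_derive1V f (x a : R) : f x != 0 -> is_derive x 1 f a ->
  is_derive x 1 (fun s => (f s)^-1) (- a / f x ^+ 2).
Proof.
move=> f0 fx; apply: is_derive_eq; rewrite /GRing.scale/= mulrC mulNr mulrN.
by [].
Qed.

Lemma is_derive1_affine (x a b : R) : is_derive x 1 (fun s => a * s + b) a.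
Proof.
rewrite -[X in is_derive _ _ _ X](_ : 0 * x + a * 1 + 0 = a); last by ring.
apply: (@is_derive1D (fun s => a * s) (cst b)).
by apply: (@is_derive1M (cst a) id).
Qed.

Lemma nbhs_pos f (x : R) : {for x, continuous f} -> 0 < f x ->
  exists2 e : R, 0 < e & forall y, `|y - x| < e -> 0 < f y.
Proof.
move=> fx f0; have /fx : nbhs (f x) [set z : R | 0 < z] by exact: lt_nbhsr.
move=> /nbhs_ballP[e /= e0 be]; exists e => // y yx.
by apply: be; rewrite /ball /= distrC.
Qed.

Lemma le_of_derive_ge0 f df (a b : R) : a <= b ->
  (forall x, a <= x <= b -> is_derive x 1 f (df x)) ->
  (forall x, a <= x <= b -> 0 <= df x) -> f a <= f b.
Proof.
move=> ab fd d0.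
have [x xab||] := @MVT_segment R f df a b ab.
- by apply: fd; move: xab; rewrite in_itv/= => /andP[/ltW-> /ltW->].
- apply: derivable_within_continuous => x; rewrite in_itv/= => /fd fx.
  exact: ex_derive.
move=> c; rewrite in_itv/= => /d0 cd E.
by rewrite -subr_ge0 E mulr_ge0// subr_ge0.
Qed.

Lemma last_zero f (a b : R) : a <= b ->
  (forall x, a <= x <= b -> {for x, continuous f}) -> f a <= 0 -> 0 < f b ->
  exists c, [/\ a <= c < b, f c = 0 & forall x, c < x <= b -> 0 < f x].
Proof.
move=> ab fc fa fb.
pose S := [set x | a <= x <= b /\ f x <= 0].
have Sa : S a by split=> //; rewrite lexx.
have ubS : ubound S b by move=> x [/andP[]].
have supS : has_sup S by split; [exists a|exists b].
pose c := sup S.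
have ac : a <= c by apply: ub_le_sup => //; exists b.
have cb : c <= b by apply: ge_sup => //; exists a.
have abc : a <= c <= b by rewrite ac.
have above x : c < x <= b -> 0 < f x.
  move=> /andP[cx xb]; rewrite ltNge; apply/negP => fx.
  suff : x <= c by rewrite leNgt cx.
  apply: ub_le_sup; first by exists b.
  by split => //; rewrite xb (le_trans ac (ltW cx)).
have fc0 : f c <= 0.
  rewrite leNgt; apply/negP => fcp.
  have [e e0 ep] := nbhs_pos (fc _ abc) fcp.
  have [x [xab fx]] := sup_adherent e0 supS; rewrite -/c => cx.
  have xc : x <= c by apply: ub_le_sup => //; exists b.
  suff : 0 < f x by rewrite ltNge fx.
  by apply: ep; rewrite ler0_norm ?subr_le0// opprB ltrBlDr -ltrBlDl.
have cltb : c < b by rewrite lt_neqAle cb andbT; apply: contraTneq fb => <-; rewrite -leNgt.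
exists c; split => //; first by rewrite ac.
apply/eqP; rewrite eq_le fc0 leNgt; apply/negP => fcn.
have cN : {for c, continuous (fun x => - f x)} by apply: continuousN; exact: fc.
have [|e e0 ep] := nbhs_pos cN; first by rewrite oppr_gt0.
pose x := Num.min b (c + e / 2).
have e20 : 0 < e / 2 by rewrite divr_gt0.
have cx : c < x by rewrite lt_min cltb ltrDl.
have xb : x <= b by rewrite ge_min lexx.
have : 0 < - f x.
  apply: ep; rewrite gtr0_norm ?subr_gt0// ltrBlDl.
  by rewrite gt_min ltrD2l [X in _ || X](_ : _ = true) ?orbT//; lra.
by rewrite oppr_gt0 ltNge (ltW (above _ _))// cx.
Qed.

Lemma first_zero f df (a b : R) : a <= b ->
  (forall x, a <= x <= b -> is_derive x 1 f (df x)) -> 0 < f a -> f b <= 0 ->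
  exists c, [/\ a < c <= b, f c = 0, forall x, a <= x < c -> 0 < f x
             & df c <= 0].
Proof.
move=> ab fd fa fb.
have opN : continuous (-%R : R -> R) by move=> z; exact: continuousN.
have [||||c] := @last_zero (f \o -%R) (- b) (- a).
- by rewrite lerN2.
- move=> x /andP[bx xa]; apply: continuous_comp; first exact: opN.
  by apply/is_derive_continuous/fd; rewrite lerNr xa lerNl bx.
- by rewrite /= opprK.
- by rewrite /= opprK.
move=> [/andP[bc ca] fc fp]; exists (- c).
have acb : a < - c <= b by rewrite ltrNr ca lerNl bc.
have fpos x : a <= x < - c -> 0 < f x.
  move=> /andP[ax xc]; rewrite -[x]opprK; apply: (fp (- x)).
  by rewrite ltrNr xc lerNl opprK.
split => //.
move: acb => /andP[ac cb].
have [fcd Efcd] := fd (- c) ltac:(by rewrite (ltW ac) cb).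
rewrite leNgt; apply/negP => d0.
move: Efcd; rewrite /derive => Efcd.
have cv : (fun h => h^-1 *: (f (h *: 1 + - c) - f (- c))) @ (0:R)^' --> df (- c).
  by rewrite -Efcd; exact: fcd.
have /cv : nbhs (df (- c)) [set z : R | 0 < z] by exact: lt_nbhsr.
move=> /nbhs_ballP[e /= e0 be].
pose d := Num.min (e / 2) ((- c - a)).
have d_gt0 : 0 < d by rewrite lt_min divr_gt0//= subr_gt0.
have dle : d <= e / 2 by rewrite ge_min lexx.
have dle2 : d <= - c - a by rewrite ge_min lexx orbT.
have : 0 < (- d)^-1 *: (f (- d *: 1 + - c) - f (- c)).
  apply: be; last by rewrite oppr_eq0 gt_eqF.
  by rewrite /ball /= sub0r opprK gtr0_norm// (le_lt_trans dle)//; lra.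
have -> : f (- c) = 0 by exact: fc.
rewrite subr0 invrN scaleNr oppr_gt0.
rewrite /GRing.scale /= mulr1 pmulr_rlt0 ?invr_gt0// ltNge ltW// fpos//.
by apply/andP; split; lra.
Qed.

(** A Gronwall inequality that constrains [f] only where it is negative: going
    back from a point with [f < 0], [-f * exp (- K t)] does not decrease, which
    contradicts the behaviour of [f] at the left end. *)
Lemma ge0_of_derive_ge f df (K a b : R) : 0 <= a -> a < b -> 0 <= K ->
  (forall x, a < x <= b -> is_derive x 1 f (df x)) ->
  (forall x, a < x <= b -> f x < 0 -> K * f x <= df x) ->
  (forall e, 0 < e -> exists2 s, a < s <= b & - e < f s) ->
  0 <= f b.
Proof.
move=> a0 ab K0 fd fK flim; rewrite leNgt; apply/negP => fb.
pose g x := - f x * expR (- K * x).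
pose dg x := (K * f x - df x) * expR (- K * x).
have gd x : a < x <= b -> is_derive x 1 g (dg x).
  move=> /fd fx; rewrite /g /dg.
  have ex : is_derive x 1 (fun s => expR (- K * s)) (expR (- K * x) * - K).
    apply: (@is_derive1_comp _ expR (fun s => - K * s)).
    by have := is_derive1_affine x (- K) 0; under eq_fun do rewrite addr0.
  by apply: (is_derive_eq (is_derive1M (is_derive1N fx) ex)); ring.
have gb : 0 < g b by rewrite mulr_gt0 ?oppr_gt0 ?expR_gt0.
have [s sab fs] := flim _ (divr_gt0 gb (ltr0n _ 2)).
have /andP[as' sb] := sab.
have gs : g s <= g b / 2.
  have es : expR (- K * s) <= 1.
    by rewrite -expR0 ler_expR mulNr oppr_le0 mulr_ge0// ltW// (le_lt_trans a0).
  have [f0|f0] := leP 0 (f s).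
    rewrite (@le_trans _ _ 0)//; last by lra.
    by rewrite /g mulNr oppr_le0 mulr_ge0// expR_ge0.
  rewrite (@le_trans _ _ (- f s))//; last by lra.
  by rewrite /g ler_piMr// oppr_ge0 ltW.
have [||||c [/andP[sc cb] gc gp]] := @last_zero (fun x => g x - g b / 2) s b.
- by [].
- move=> x /andP[sx xb]; apply: (@continuousB _ _ _ g); last exact: cvg_cst.
  by apply/is_derive_continuous/gd; rewrite xb (lt_le_trans as').
- by rewrite subr_le0.
- by rewrite subr_gt0; lra.
suff : g b <= g c by move/eqP: gc; rewrite subr_eq0 => /eqP ->; lra.
rewrite -lerN2; apply: (@le_of_derive_ge0 (fun x => - g x) (fun x => - dg x)).
- exact: ltW.
- move=> x /andP[cx xb].
  by apply/is_deriveN/gd; rewrite xb (lt_le_trans as' (le_trans sc cx)).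
move=> x /andP[cx xb].
have gx : 0 < g x.
  have [<-|cx'] := eqVneq c x; first by move/eqP: gc; rewrite subr_eq0 => /eqP ->; lra.
  have : 0 < g x - g b / 2 by apply: gp; rewrite xb lt_neqAle cx' cx.
  lra.
have fx : f x < 0 by move: gx; rewrite /g pmulr_lgt0 ?expR_gt0// oppr_gt0.
rewrite /dg -mulNr mulr_ge0 ?expR_ge0// opprB subr_ge0 fK//.
by rewrite xb (lt_le_trans as' (le_trans sc cx)).
Qed.

End Calculus.

(** * The linear part of the soliton equations *)

(** With [y = - u'], [E = - C - eps * u], [xi = tr L - u'], [Q = tr (L ^ 2)] and
    [h = eps / 2], the conservation law reads [y' = E - xi * y], and the traced
    Riccati equation [xi' = h - Q].  The mean curvature, hence [xi], is unbounded
    at [0]; but [xi - h * t] does not increase, which bounds [xi] from below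
    there. *)

Section LinearSystem.
Context {R : realType}.
Variables (h : R) (y E xi Q : R -> R) (e0 : R).
Hypothesis h_gt0 : 0 < h.
Hypothesis dy : forall t : R, 0 < t -> is_derive t 1 y (E t - xi t * y t).
Hypothesis dE : forall t : R, 0 < t -> is_derive t 1 E (2 * h * y t).
Hypothesis dxi : forall t : R, 0 < t -> is_derive t 1 xi (h - Q t).
Hypothesis Q_ge0 : forall t : R, 0 < t -> 0 <= Q t.
Hypothesis y_lim : y t @[t --> 0^'+] --> 0.
Hypothesis E_lim : E t @[t --> 0^'+] --> e0.

Lemma at_right_ge (f : R -> R) (l m b : R) : 0 < b ->
  f t @[t --> 0^'+] --> l -> (forall s, 0 < s <= b -> m <= f s) -> m <= l.
Proof.
move=> b0 fl fm; apply: (cvgr_to_ge fl).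
by near=> s; apply: fm; apply/andP; split; near: s;
  [exact: nbhs_right_gt|exact: nbhs_right_le].
Unshelve. all: by end_near. Qed.

Lemma at_right_freq (f : R -> R) (l m b : R) : 0 < b ->
  f t @[t --> 0^'+] --> l -> m < l -> exists2 s, 0 < s <= b & m < f s.
Proof.
move=> b0 fl ml; apply: contrapT => nex.
suff : - m <= - l by rewrite lerN2 leNgt ml.
apply: (@at_right_ge (fun t => - f t) _ _ b b0); first exact: cvgN.
move=> s sb; rewrite lerN2 leNgt; apply/negP => mf; apply: nex.
by exists s.
Qed.

Lemma xi_slope (s t : R) : 0 < s -> s <= t -> xi t - h * t <= xi s - h * s.
Proof.
move=> s0 st.
rewrite -lerN2.
apply: (@le_of_derive_ge0 _ (fun x => - (xi x - h * x)) Q) => //.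
- move=> x /andP[sx _].
  have hx : is_derive x 1 (fun s : R => h * s) h.
    by have := is_derive1_affine x h 0; under eq_fun do rewrite addr0.
  apply: (is_derive_eq (is_derive1N (is_derive1B (dxi _) hx))); first exact: lt_le_trans sx.
  ring.
by move=> x /andP[sx _]; apply: Q_ge0; exact: lt_le_trans sx.
Qed.

Lemma xi_lower (b : R) : 0 < b ->
  exists2 K, 0 <= K & forall t, 0 < t <= b -> - K <= xi t.
Proof.
move=> b0; exists (`|xi b| + h * b) => [|t /andP[t0 tb]].
  by rewrite addr_ge0// mulr_ge0 ?ltW.
have := xi_slope t0 tb; have := mulr_ge0 (ltW h_gt0) (ltW t0).
have := ler_norm (- xi b); rewrite normrN; lra.
Qed.

(** [exp (int xi)] is an integrating factor for [V' >= - xi * V]; where [V < 0],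
    a lower bound of [xi] is enough to compare with a constant rate. *)
Lemma ge0_of_drift (V dV : R -> R) (l b : R) : 0 < b -> 0 <= l ->
  V t @[t --> 0^'+] --> l ->
  (forall t, 0 < t <= b -> is_derive t 1 V (dV t)) ->
  (forall t, 0 < t <= b -> V t < 0 -> - (xi t * V t) <= dV t) -> 0 <= V b.
Proof.
move=> b0 l0 Vl Vd VdV; have [K K0 xiK] := xi_lower b0.
apply: (@ge0_of_derive_ge _ V dV K 0 b) => //.
- move=> t tb Vt; apply: le_trans (VdV _ tb Vt).
  by rewrite -mulNr; apply: ler_wnM2r; [exact: ltW|rewrite lerNl xiK].
- by move=> e e_gt0; apply: (at_right_freq b0 Vl); rewrite (lt_le_trans _ l0)// oppr_lt0.
Qed.

(** [(y * E)' + xi * (y * E) = E ^ 2 + 2 * h * y ^ 2 >= 0]. *)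
Lemma yE_ge0 (t : R) : 0 < t -> 0 <= y t * E t.
Proof.
move=> t0.
apply: (@ge0_of_drift (fun t => y t * E t)
   (fun t => (E t - xi t * y t) * E t + y t * (2 * h * y t)) 0) => //.
- by rewrite -[X in _ --> X](mul0r e0); exact: cvgM.
- move=> s /andP[s0 _]; exact: is_derive1M (dy s0) (dE s0).
move=> s /andP[s0 _] _.
have : 0 <= E s ^+ 2 + 2 * h * y s ^+ 2.
  by rewrite addr_ge0 ?sqr_ge0// mulr_ge0 ?sqr_ge0// mulr_ge0// ltW.
lra.
Qed.

(** [(E ^ 2)' = 4 * h * (y * E) >= 0], so [E] keeps the sign of its initial
    value. *)
Lemma E_sqr_ge (t : R) : 0 < t -> e0 ^+ 2 <= E t ^+ 2.
Proof.
move=> t0; rewrite -lerN2.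
have El : - E t ^+ 2 @[t --> 0^'+] --> - e0 ^+ 2.
  by under eq_fun do rewrite expr2; rewrite expr2; apply: cvgN; exact: cvgM.
apply: (at_right_ge t0 El) => s /andP[s0 st]; rewrite lerN2.
apply: (@le_of_derive_ge0 _ (fun t => E t ^+ 2) (fun t => 4 * h * (y t * E t))) => //.
- move=> x /andP[sx _]; have x0 := lt_le_trans s0 sx.
  under eq_fun do rewrite expr2.
  by apply: (is_derive_eq (is_derive1M (dE x0) (dE x0))); ring.
- move=> x /andP[sx _]; have x0 := lt_le_trans s0 sx.
  by rewrite mulr_ge0 ?yE_ge0// mulr_ge0// ltW.
Qed.

Lemma linear_pos (t : R) : 0 < e0 -> 0 < t -> 0 < E t /\ 0 < y t.
Proof.
move=> e00.
have Epos s : 0 < s -> 0 < E s.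
  move=> s0; rewrite ltNge; apply/negP => Es.
  have [r /andP[r0 rs] Er] := at_right_freq s0 E_lim e00.
  have dEr x : r <= x <= s -> is_derive x 1 E (2 * h * y x).
    by move=> /andP[rx _]; apply: dE; exact: lt_le_trans rx.
  have [c [/andP[rc _] Ec _ _]] := first_zero rs dEr Er Es.
  have := E_sqr_ge (lt_trans r0 rc); rewrite Ec expr0n/= leNgt.
  by rewrite exprn_gt0.
move=> t0; split; first exact: Epos.
have yge s : 0 < s -> 0 <= y s.
  by move=> s0; have := yE_ge0 s0; rewrite pmulr_lge0 ?Epos.
rewrite lt_neqAle yge// andbT; apply/eqP => yt.
have : is_derive t 1 y 0.
  apply: (@derive1_at_min _ y 0 (2 * t)).
  - by rewrite mulr_ge0// ltW.
  - move=> s; rewrite in_itv/= => /andP[s0 _].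
    by have := dy s0 => ?; exact: ex_derive.
  - by rewrite in_itv/= t0; lra.
  - by move=> s; rewrite in_itv/= => /andP[s0 _]; rewrite -yt yge.
have [_ Ey] := dy t0; case=> [_]; rewrite Ey -yt mulr0 subr0 => E0.
by have := Epos _ t0; rewrite E0 ltxx.
Qed.

(** Gronwall's inequality for [y ^ 2 + E ^ 2], with the lower bound of [xi]. *)
Lemma linear_zero (t : R) : e0 = 0 -> 0 < t -> E t = 0.
Proof.
move=> e00 t0.
have [K K0 xiK] := xi_lower t0.
have : 0 <= - (y t * y t + E t * E t).
  apply: (@ge0_of_derive_ge _ (fun t => - (y t * y t + E t * E t))
    (fun t => - (((E t - xi t * y t) * y t + y t * (E t - xi t * y t))
             + (2 * h * y t * E t + E t * (2 * h * y t)))) (1 + 2 * h + 2 * K) 0) => //.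
  - by have := h_gt0; lra.
  - by move=> s /andP[s0 _]; apply/is_derive1N/is_derive1D;
      apply: is_derive1M; first [exact: dy|exact: dE].
  - move=> s st _.
    have h1 : 0 <= (1 + 2 * h) * (y s - E s) ^+ 2.
      by rewrite mulr_ge0 ?sqr_ge0//; have := h_gt0; lra.
    have h2 : 0 <= 2 * (xi s + K) * y s ^+ 2.
      by rewrite mulr_ge0 ?sqr_ge0//; have := xiK _ st; lra.
    have h3 : 0 <= 2 * K * E s ^+ 2 by rewrite mulr_ge0 ?sqr_ge0// mulr_ge0.
    lra.
  - move=> e e_gt0; apply: (@at_right_freq _ 0 _ _ t0); last by rewrite oppr_lt0.
    have := cvgN (cvgD (cvgM y_lim y_lim) (cvgM E_lim E_lim)).
    by rewrite e00 mulr0 addr0 oppr0; apply.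
have := sqr_ge0 (y t); have := sqr_ge0 (E t); rewrite !expr2 => h1 h2 h3.
have : E t * E t = 0 by lra.
by move/eqP; rewrite mulf_eq0 orbb => /eqP.
Qed.

End LinearSystem.

(** * Finite time blow-up *)

(** A solution of [F'' + w F' >= kappa F ^ 2] with linear [w = h * t + c] blows up
    in finite time.  With [r = sqrt F], the inequality [w F' > 2 b r ^ 3] persists
    once it holds, provided that [b] is small; it makes [- 1 / r - (b / h) ln w]
    nondecreasing, which is absurd because [- 1 / r < 0] and [ln w] is
    unbounded. *)
Lemma quadratic_blowup (R : realType) (h c kappa a : R) (F dF ddF : R -> R) :
  0 < h -> 0 < c -> 0 < kappa -> 0 < a ->
  (forall t, a <= t -> is_derive t 1 F (dF t)) ->
  (forall t, a <= t -> is_derive t 1 dF (ddF t)) ->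
  (forall t, a <= t -> 0 <= F t -> 0 <= dF t ->
     kappa * F t ^+ 2 - (h * t + c) * dF t <= ddF t) ->
  0 < F a -> 0 < dF a -> False.
Proof.
move=> h0 c0 k0 a0 dF1 dF2 Fineq Fa dFa.
pose w t := h * t + c.
have w0 t : a <= t -> 0 < w t.
  by move=> at_; rewrite addr_gt0// mulr_gt0// (lt_le_trans a0).
have Fmono t : a <= t -> (forall s, a <= s < t -> 0 < dF s) -> F a <= F t.
  move=> at_ dFp; rewrite leNgt; apply/negP => Ft.
  have dFt : 0 <= dF t.
    have cdF := is_derive_continuous (dF2 _ at_).
    have ta : t != a by apply: contraTneq Ft => ->; rewrite ltxx.
    have lta : a < t by rewrite lt_neqAle eq_sym ta.
    rewrite leNgt; apply/negP => dFt0.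
    have cN : {for t, continuous (fun x => - dF x)} by apply: continuousN.
    have [|e e0 ep] := nbhs_pos cN; first by rewrite oppr_gt0.
    pose s := Num.max a (t - e / 2).
    have as_ : a <= s by rewrite le_max lexx.
    have st : s < t by rewrite gt_max lta/= ltrBlDr ltrDl divr_gt0.
    have se : t - e / 2 <= s by rewrite le_max lexx orbT.
    have : 0 < - dF s by apply: ep; rewrite ltr0_norm ?subr_lt0//; lra.
    by have := dFp s; rewrite as_ st => /(_ isT); lra.
  suff : F a <= F t by rewrite leNgt Ft.
  apply: (@le_of_derive_ge0 _ F dF) => // x /andP[ax xt]; first exact: dF1.
  have [->//|xt'] := eqVneq x t.
  by rewrite ltW// dFp// ax lt_neqAle xt' xt.
have dFpos t : a <= t -> 0 < dF t.
  move=> at_; rewrite ltNge; apply/negP => dFt.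
  have ddFat x : a <= x <= t -> is_derive x 1 dF (ddF x).
    by move=> /andP[ax _]; exact: dF2.
  have [d [/andP[ad dt] dFd dFp ddFd]] := first_zero at_ ddFat dFa dFt.
  have Fd : 0 < F d by apply: (lt_le_trans Fa); apply: Fmono => //; exact: ltW.
  have := Fineq d (ltW ad) (ltW Fd); rewrite dFd lexx => /(_ isT).
  rewrite mulr0 subr0 => H.
  have := lt_le_trans (mulr_gt0 k0 (exprn_gt0 2 Fd)) H.
  by rewrite ltNge ddFd.
have FgeFa t : a <= t -> F a <= F t.
  by move=> at_; apply: Fmono => // s /andP[as_ _]; exact: dFpos.
have F0 t : a <= t -> 0 < F t by move=> at_; exact: lt_le_trans (FgeFa _ at_).
pose r t := Num.sqrt (F t).
have r0 t : a <= t -> 0 < r t by move=> at_; rewrite sqrtr_gt0 F0.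
have rF t : a <= t -> F t = r t ^+ 2 by move=> at_; rewrite sqr_sqrtr// ltW ?F0.
have rra t : a <= t -> r a <= r t.
  by move=> at_; rewrite ler_wsqrtr// FgeFa.
have dr t : a <= t -> is_derive t 1 r (dF t / (2 * r t)).
  move=> at_; have := is_derive1_comp (is_derive1_sqrt (F0 _ at_)) (dF1 _ at_).
  by move=> H; apply: (is_derive_eq H); rewrite mulrC.
have aa : a <= a by [].
have [ra wa] := (r0 _ aa, w0 _ aa).
(* [b] is small enough for [w F' = 2 b r^3] to force [(w F' - 2 b r^3)' > 0] *)
have [b [b0 b1 b2 b3]] : exists b : R, [/\ 0 < b, 8 * b <= kappa * r a,
    24 * b ^+ 2 <= kappa * w a ^+ 2 & 2 * b * r a ^+ 3 < w a * dF a].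
  pose b1 := kappa * r a / 8.
  pose b2 := Num.min 1 (kappa * w a ^+ 2 / 24).
  pose b3 := w a * dF a / (4 * r a ^+ 3).
  have r3 : 0 < r a ^+ 3 by exact: exprn_gt0.
  have b10 : 0 < b1 by rewrite divr_gt0// mulr_gt0.
  have b20 : 0 < b2 by rewrite lt_min ltr01/= divr_gt0// mulr_gt0// exprn_gt0.
  have b30 : 0 < b3 by rewrite divr_gt0 ?mulr_gt0// ?dFpos.
  pose b := Num.min b1 (Num.min b2 b3).
  have b_gt0 : 0 < b by rewrite lt_min b10 lt_min b20 b30.
  have bb1 : b <= b1 by rewrite ge_min lexx.
  have bb2 : b <= b2 by rewrite ge_min [X in _ || X]ge_min lexx orbT.
  have bb3 : b <= b3 by rewrite ge_min [X in _ || X]ge_min lexx !orbT.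
  have b21 : b2 <= 1 by rewrite ge_min lexx.
  have b2w : b2 <= kappa * w a ^+ 2 / 24 by rewrite ge_min lexx orbT.
  exists b; split => //.
  - by move: bb1; rewrite /b1; lra.
  - have : b ^+ 2 <= b by rewrite expr2; apply: ler_piMl; [exact: ltW|exact: le_trans b21].
    by move: (le_trans bb2 b2w); lra.
  - have : b * (4 * r a ^+ 3) <= w a * dF a.
      by rewrite -ler_pdivlMr// mulr_gt0.
    have : 0 < b * r a ^+ 3 by rewrite mulr_gt0.
    lra.
pose G t := w t * dF t - 2 * b * (F t * r t).
pose dG t := (h * dF t + w t * ddF t)
  - 2 * b * (dF t * r t + F t * (dF t / (2 * r t))).
have wd (t : R) : is_derive t 1 w h by exact: is_derive1_affine.
have Gd t : a <= t -> is_derive t 1 G (dG t).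
  move=> at_; apply: is_derive1B; first exact: is_derive1M (wd t) (dF2 _ at_).
  have := is_derive1M (is_derive_cst (2 * b : R) t 1)
             (is_derive1M (dF1 _ at_) (dr _ at_)).
  by move=> H; apply: (is_derive_eq H); rewrite mul0r add0r.
have Gpos t : a <= t -> 0 < G t.
  move=> at_; rewrite ltNge; apply/negP => Gt.
  have Gda x : a <= x <= t -> is_derive x 1 G (dG x).
    by move=> /andP[ax _]; exact: Gd.
  have Ga : 0 < G a by rewrite /G (rF _ aa); lra.
  have [d [/andP[ad0 dt] Gd0 _ dGd]] := first_zero at_ Gda Ga Gt.
  have ad := ltW ad0.
  have [[[rd wd0] dFd] Fd] := (r0 _ ad, w0 _ ad, dFpos _ ad, F0 _ ad).
  have rad := rra _ ad.
  have wad : w a <= w d by rewrite lerD2r ler_pM2l.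
  have E1 : w d * dF d = 2 * b * r d ^+ 3.
    by move: Gd0; rewrite /G (rF _ ad) => /eqP; rewrite subr_eq0 => /eqP ->; ring.
  have := Fineq d ad (ltW Fd) (ltW dFd); rewrite -/(w d) E1 => ddFd.
  have dFE : dF d = 2 * b * r d ^+ 3 / w d by rewrite -E1 mulrC mulKf// gt_eqF.
  suff : 0 < dG d by rewrite ltNge dGd.
  have -> : dG d = h * dF d + w d * ddF d - 3 * b * (r d * dF d).
    by rewrite /dG (rF _ ad); field; rewrite gt_eqF.
  have H1 : w d * (kappa * F d ^+ 2 - 2 * b * r d ^+ 3) <= w d * ddF d.
    by rewrite ler_pM2l.
  have H2 : 0 < h * dF d by rewrite mulr_gt0.
  have r3 : 0 < r d ^+ 3 by exact: exprn_gt0.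
  have H3 : 3 * b * (r d * dF d) <= kappa * w d * r d ^+ 4 / 4.
    rewrite dFE (_ : 3 * b * _ = (24 * b ^+ 2) * (r d ^+ 4 / (4 * w d))); last first.
      by field; rewrite gt_eqF.
    rewrite (_ : kappa * _ * _ / 4 = (kappa * w d ^+ 2) * (r d ^+ 4 / (4 * w d))); last first.
      by field; rewrite gt_eqF.
    rewrite ler_wpM2r//.
      by rewrite divr_ge0 ?exprn_ge0 ?mulr_ge0// ltW.
    apply: (le_trans b2); rewrite ler_pM2l// lerXn2r// nnegrE ltW//.
  have H4 : w d * (2 * b * r d ^+ 3) <= kappa * w d * r d ^+ 4 / 4.
    rewrite (_ : kappa * _ * _ / 4 = (w d * r d ^+ 3) * (kappa * r d / 4)); last by ring.
    rewrite (_ : w d * _ = (w d * r d ^+ 3) * (2 * b)); last by ring.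
    rewrite ler_pM2l ?mulr_gt0//.
    have : kappa * r a <= kappa * r d by rewrite ler_pM2l.
    lra.
  have H5 : 0 < kappa * w d * r d ^+ 4 by rewrite !mulr_gt0// exprn_gt0.
  move: H1; rewrite (rF _ ad) -exprM mulrBr => H1.
  move: H1 H4; rewrite mulrCA mulrA => H1 H4; lra.
pose Phi t := - (r t)^-1 - b / h * ln (w t).
pose dPhi t := dF t / (2 * r t) / r t ^+ 2 - b / w t.
have Phid t : a <= t -> is_derive t 1 Phi (dPhi t).
  move=> at_; have [rt wt] := (r0 _ at_, w0 _ at_).
  have lnd : is_derive t 1 (fun s => ln (w s)) ((w t)^-1 * h).
    exact: (@is_derive1_comp _ (@ln R) w) (is_derive1_ln wt) (wd t).
  have rinv := is_derive1N (is_derive1V (lt0r_neq0 rt) (dr _ at_)).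
  have bln := is_derive1M (is_derive_cst (b / h : R) t 1) lnd.
  apply: (is_derive_eq (is_derive1B rinv bln)).
  by rewrite /dPhi mul0r add0r /=; field; rewrite !gt_eqF.
have Phimono t : a <= t -> Phi a <= Phi t.
  move=> at_; apply: (@le_of_derive_ge0 _ Phi dPhi) => // x /andP[ax _].
    exact: Phid.
  have [rx wx] := (r0 _ ax, w0 _ ax).
  rewrite /dPhi (_ : _ - _ = (w x * dF x - 2 * b * r x ^+ 3) / (2 * r x ^+ 3 * w x)).
    rewrite divr_ge0//; last by rewrite ltW// !mulr_gt0// exprn_gt0.
    by have := Gpos x ax; rewrite /G (rF _ ax); lra.
  by field; rewrite !gt_eqF.
(* at this time [ln w] exceeds the value allowed by [Phi a <= Phi] *)
pose X := Num.max (ln (w a)) (- Phi a * (h / b)).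
pose t := (expR X - c) / h.
have wt : w t = expR X by rewrite /w /t mulrC divfK ?subrK// gt_eqF.
have at_ : a <= t.
  rewrite ler_pdivlMr// lerBrDr [a * h]mulrC -/(w a) -[w a]lnK//.
  by rewrite ler_expR le_max lexx.
have := Phimono _ at_; rewrite {2}/Phi wt expRK.
have : - Phi a <= b / h * X.
  rewrite -ler_pdivrMl ?divr_gt0// invf_div mulrC.
  by rewrite le_max lexx orbT.
have : 0 < (r t)^-1 by rewrite invr_gt0 r0.
lra.
Qed.

(** * The soliton equations *)

Section SolitonSystem.
Context {R : realType}.
Variables (h N : R) (y E xi Q : R -> R) (e0 : R).
Hypothesis h_gt0 : 0 < h.
Hypothesis N_ge0 : 0 <= N.
Hypothesis dy : forall t : R, 0 < t -> is_derive t 1 y (E t - xi t * y t).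
Hypothesis dE : forall t : R, 0 < t -> is_derive t 1 E (2 * h * y t).
Hypothesis dxi : forall t : R, 0 < t -> is_derive t 1 xi (h - Q t).
Hypothesis Q_ge0 : forall t : R, 0 < t -> 0 <= Q t.
Hypothesis Q_trace : forall t : R, 0 < t -> (xi t - y t) ^+ 2 <= N * Q t.
Hypothesis y_lim : y t @[t --> 0^'+] --> 0.
Hypothesis E_lim : E t @[t --> 0^'+] --> e0.

Let p t := E t - xi t * y t.
Let dp t := h * y t + Q t * y t - xi t * p t.
Let F t := y t ^+ 2 - E t.
Let dF t := 2 * (y t * (p t - h)).
Let ddF t := 2 * (p t * (p t - h) + y t * dp t).

Let dp_at (t : R) : 0 < t -> is_derive t 1 p (dp t).
Proof.
move=> t0; apply: (is_derive_eq (is_derive1B (dE t0) (is_derive1M (dxi t0) (dy t0)))).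
by rewrite /dp /p; ring.
Qed.

Let dF_at (t : R) : 0 < t -> is_derive t 1 F (dF t).
Proof.
move=> t0; rewrite /F; under eq_fun do rewrite expr2.
apply: (is_derive_eq (is_derive1B (is_derive1M (dy t0) (dy t0)) (dE t0))).
by rewrite /dF /p; ring.
Qed.

Let ddF_at (t : R) : 0 < t -> is_derive t 1 dF (ddF t).
Proof.
move=> t0; rewrite /dF.
have ph := is_derive1B (dp_at t0) (is_derive_cst (h : R) t 1).
apply: (is_derive_eq (is_derive1M (is_derive_cst (2 : R) t 1) (is_derive1M (dy t0) ph))).
by rewrite /ddF /= -/(p t); ring.
Qed.

(** The elliptic equation of the scalar curvature of a soliton: [F] is the
    Laplacian of [u], equal to minus the scalar curvature up to a constant, and
    [p ^+ 2 + Q * y ^+ 2] is the squared norm of the Hessian of [u], which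
    dominates [F ^+ 2 / (1 + N)] by Cauchy--Schwarz. *)
Lemma laplacian_ineq (t : R) : 0 < t ->
  2 / (1 + N) * F t ^+ 2 + 2 * h * F t <= ddF t + xi t * dF t.
Proof.
move=> t0.
have -> : ddF t + xi t * dF t =
    2 * (p t ^+ 2 + Q t * y t ^+ 2) + 2 * h * F t.
  by rewrite /ddF /dF /F /dp /p; ring.
rewrite lerD2r -mulrA ler_pM2l// ler_pdivrMl ?ltr_pwDl//.
set T := xi t - y t.
have -> : F t = - (p t + T * y t) by rewrite /F /p /T; ring.
have TQ : T ^+ 2 <= N * Q t by exact: Q_trace.
have Q0 := Q_ge0 t0.
have cross : 2 * p t * (T * y t) <= N * p t ^+ 2 + Q t * y t ^+ 2.
  have rhs0 : 0 <= N * p t ^+ 2 + Q t * y t ^+ 2.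
    by rewrite addr_ge0// mulr_ge0 ?sqr_ge0.
  apply: (le_trans (ler_norm _)); rewrite -ler_sqr ?nnegrE//.
  rewrite real_normK ?num_real//.
  have : p t ^+ 2 * y t ^+ 2 * T ^+ 2 <= p t ^+ 2 * y t ^+ 2 * (N * Q t).
    by apply: ler_wpM2l => //; rewrite mulr_ge0 ?sqr_ge0.
  have := sqr_ge0 (N * p t ^+ 2 - Q t * y t ^+ 2); lra.
have : T ^+ 2 * y t ^+ 2 <= N * Q t * y t ^+ 2.
  by rewrite ler_wpM2r ?sqr_ge0.
lra.
Qed.

(** Since [xi] grows at most linearly, [laplacian_ineq] would make [F] blow up,
    whereas the equations hold for all times. *)
Lemma F_not_increasing (a : R) : 0 < a -> 0 < F a -> dF a <= 0.
Proof.
move=> a0 Fa; rewrite leNgt; apply/negP => dFa.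
apply: (@quadratic_blowup R h (`|xi a| + 1) (2 / (1 + N)) a F dF ddF) => //.
- by rewrite divr_gt0// ltr_pwDl.
- by move=> t at_; apply: dF_at; exact: lt_le_trans at_.
- by move=> t at_; apply: ddF_at; exact: lt_le_trans at_.
move=> t at_ Ft dFt; have t0 := lt_le_trans a0 at_.
have := laplacian_ineq t0.
have xit : xi t <= h * t + (`|xi a| + 1).
  have := xi_slope dxi Q_ge0 a0 at_.
  have : 0 < h * a by rewrite mulr_gt0.
  have := ler_norm (xi a); lra.
have : xi t * dF t <= (h * t + (`|xi a| + 1)) * dF t by rewrite ler_wpM2r.
have : 0 <= 2 * h * F t by rewrite !mulr_ge0// ltW.
lra.
Qed.

(** If [e0 < 0] then [y] and [E] are negative, so [F > 0] and [F] does not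
    increase; then [y ^ 2 = F + E <= - e0 + e0 = 0]. *)
Lemma E0_ge0 : 0 <= e0.
Proof.
rewrite leNgt; apply/negP => e00.
have neg t : 0 < t -> 0 < - E t /\ 0 < - y t.
  apply: (@linear_pos _ h (fun t => - y t) (fun t => - E t) xi Q (- e0)) => //.
  - by move=> s s0; apply: (is_derive_eq (is_derive1N (dy s0))); ring.
  - by move=> s s0; apply: (is_derive_eq (is_derive1N (dE s0))); ring.
  - by rewrite -[X in _ --> X]oppr0; exact: cvgN.
  - exact: cvgN.
  - by rewrite oppr_gt0.
have Fpos t : 0 < t -> 0 < F t.
  move=> /neg[Et _]; rewrite /F; have := sqr_ge0 (y t); lra.
have F_lim : F t @[t --> 0^'+] --> 0 ^+ 2 - e0.
  rewrite /F; under eq_fun do rewrite expr2.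
  by rewrite expr2; apply: cvgB => //; exact: cvgM.
have t0 : (0 : R) < 1 by [].
have F1 : F 1 <= 0 ^+ 2 - e0.
  apply: (at_right_ge t0 F_lim) => s /andP[s0 s1]; rewrite -lerN2.
  apply: (@le_of_derive_ge0 _ (fun t => - F t) (fun t => - dF t)) => //.
    move=> x /andP[sx _]; apply: is_derive1N; apply: dF_at; exact: lt_le_trans sx.
  move=> x /andP[sx _]; have x0 := lt_le_trans s0 sx.
  by rewrite oppr_ge0; apply: F_not_increasing => //; exact: Fpos.
have E1 : E 1 <= e0.
  apply: (at_right_ge t0 E_lim) => s /andP[s0 s1]; rewrite -lerN2.
  apply: (@le_of_derive_ge0 _ (fun t => - E t) (fun t => - (2 * h * y t))) => //.
    by move=> x /andP[sx _]; apply: is_derive1N; apply: dE; exact: lt_le_trans sx.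
  move=> x /andP[sx _]; have [_ yx] := neg _ (lt_le_trans s0 sx).
  by rewrite -mulrN !mulr_ge0// ltW.
have [_ y1] := neg _ t0.
have : 0 < y 1 ^+ 2 by rewrite -sqrrN exprn_gt0.
move: F1; rewrite expr0n/= /F; lra.
Qed.

Lemma E_y_pos (t : R) : 0 < e0 -> 0 < t -> 0 < E t /\ 0 < y t.
Proof. exact: (linear_pos h_gt0 dy dE dxi Q_ge0 y_lim E_lim). Qed.

(** The Laplacian [F] starts at [- e0 < 0], and it cannot increase to a positive
    value. *)
Lemma y_sqr_le (t : R) : 0 < e0 -> 0 < t -> y t ^+ 2 <= E t.
Proof.
move=> e00 t0; rewrite -subr_le0 -/(F t) leNgt; apply/negP => Ft.
have F_lim : - F t @[t --> 0^'+] --> - (0 ^+ 2 - e0).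
  rewrite /F; under eq_fun do rewrite expr2.
  by rewrite expr2; apply: cvgN; apply: cvgB => //; exact: cvgM.
have [|s /andP[s0 st] Fs] := at_right_freq t0 F_lim (_ : 0 < _).
  by rewrite expr0n/= sub0r opprK.
have [|||c [/andP[sc ct] Fc Fp]] := @last_zero _ (fun x => F x - F t / 2) s t st.
- move=> x /andP[sx _]; apply: (@continuousB _ _ _ F); last exact: cvg_cst.
  by apply/is_derive_continuous/dF_at; exact: lt_le_trans sx.
- by move: Fs; rewrite oppr_gt0 => Fs; lra.
- lra.
have c0 := lt_le_trans s0 sc.
have [x xc||x] := @MVT_segment R F dF c t (ltW ct).
- by apply: dF_at; move: xc; rewrite in_itv/= => /andP[cx _]; exact: lt_trans cx.
- apply: derivable_within_continuous => x; rewrite in_itv/= => /andP[cx _].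
  by have := dF_at (lt_le_trans c0 cx) => ?; exact: ex_derive.
rewrite in_itv/= => /andP[cx xt] Ex.
have Fx : 0 < F x.
  have [<-|cx'] := eqVneq c x; first by lra.
  have : 0 < F x - F t / 2 by apply: Fp; rewrite xt lt_neqAle cx' cx.
  lra.
have := F_not_increasing (lt_le_trans c0 cx) Fx.
apply/negP; rewrite -ltNge.
have : 0 < dF x * (t - c) by rewrite -Ex; lra.
by rewrite pmulr_lgt0// subr_gt0.
Qed.

(** [sqrt E] has derivative [h * y / sqrt E <= h]. *)
Lemma y_le_affine (t : R) : 0 < e0 -> 0 < t -> y t <= Num.sqrt e0 + h * t.
Proof.
move=> e00 t0; set k := Num.sqrt e0.
have k0 : 0 < k by rewrite sqrtr_gt0.
have k2 : k ^+ 2 = e0 by rewrite sqr_sqrtr// ltW.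
have bpos s : 0 < s -> k < k + h * s by move=> s0; rewrite ltrDl mulr_gt0.
suff Et : 0 <= (k + h * t) ^+ 2 - E t.
  have [_ yt] := E_y_pos e00 t0.
  rewrite -ler_sqr ?nnegrE; [|exact: ltW|by rewrite ltW// (lt_trans k0 (bpos _ t0))].
  by apply: (le_trans (y_sqr_le e00 t0)); rewrite -subr_ge0.
have bd (s : R) : is_derive s 1 (fun s => k + h * s) h.
  by have := is_derive1_affine s h k; under eq_fun do rewrite addrC.
apply: (@ge0_of_derive_ge _ (fun t => (k + h * t) ^+ 2 - E t)
   (fun t => 2 * h * (k + h * t) - 2 * h * y t) (2 * h / k) 0).
- exact: lexx.
- exact: t0.
- by rewrite divr_ge0 ?mulr_ge0// ltW.
- move=> s /andP[s0 _]; under eq_fun do rewrite expr2.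
  by apply: (is_derive_eq (is_derive1B (is_derive1M (bd s) (bd s)) (dE s0))); ring.
- move=> s /andP[s0 _] Bs.
  rewrite -mulrBr -[2 * h / k * _]mulrA ler_pM2l ?mulr_gt0// mulrC.
  rewrite ler_pdivrMr//.
  have [sy|ys] := leP (y s) (k + h * s).
    by apply: (le_trans (ltW Bs)); rewrite mulr_ge0 ?subr_ge0// ltW.
  have := y_sqr_le e00 s0; have := bpos _ s0.
  set b := k + h * s in ys *; move=> kb yE.
  have : 0 <= (y s - b) * (y s + b - k).
    by rewrite mulr_ge0//; lra.
  lra.
move=> e e_gt0; apply: (@at_right_freq _ _ (k ^+ 2 - e0)) => //; last first.
  by rewrite k2 subrr oppr_lt0.
apply: cvgB => //.
have -> : k ^+ 2 = (k + h * 0) ^+ 2 by rewrite mulr0 addr0.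
apply: cvg_at_right_filter.
exact: (is_derive_continuous (is_derive1M (bd 0) (bd 0))).
Qed.

(** The quotient [E / y = y' / y + xi] solves a Riccati equation that is monotone
    in [xi], and [xi' <= h] bounds [xi] from below before time [b] by the line
    [l0] of slope [h] through [xi b].  When [l >= l0] is the parallel line through
    [m] at time [b], [l0 + h / l] is a subsolution for [l0]; the sign of
    [V = y * l * (E / y - l0 - h / l)] propagates from [0] to [b], where it
    reads [m * y' >= h * y]. *)
Lemma log_derivative_ge (b m : R) : 0 < e0 -> 0 < b -> h * b <= m -> xi b <= m ->
  h * y b <= m * (E b - xi b * y b).
Proof.
move=> e00 b0 hbm xim.
pose l t := m - h * b + h * t.
pose l0 t := xi b - h * b + h * t.
pose V t := E t * l t - y t * (l0 t * l t + h).
have ld (s : R) : is_derive s 1 l h.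
  by rewrite /l; have := is_derive1_affine s h (m - h * b); under eq_fun do rewrite addrC.
have l0d (s : R) : is_derive s 1 l0 h.
  by rewrite /l0; have := is_derive1_affine s h (xi b - h * b); under eq_fun do rewrite addrC.
have lc (f : R -> R) : (forall s : R, is_derive s 1 f h) -> f t @[t --> 0^'+] --> f 0.
  move=> fd; apply: cvg_at_right_filter; exact: is_derive_continuous (fd 0).
suff : 0 <= V b.
  rewrite /V /l /l0 !subrK; lra.
apply: (@ge0_of_drift _ h xi Q h_gt0 dxi Q_ge0 V
   (fun t => (2 * h * y t * l t + E t * h) -
     ((E t - xi t * y t) * (l0 t * l t + h) + y t * (h * l t + l0 t * h)))
   (e0 * l 0 - 0 * (l0 0 * l 0 + h))) => //.
- by rewrite mul0r subr0 mulr_ge0 ?(ltW e00)// /l mulr0 addr0 subr_ge0.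
- apply: cvgB; first by apply: cvgM => //; exact: lc.
  apply: cvgM => //; apply: cvgD; last exact: cvg_cst.
  by apply: cvgM; exact: lc.
- move=> t /andP[t0 _].
  have qd := is_derive1D (is_derive1M (l0d t) (ld t)) (is_derive_cst (h : R) t 1).
  apply: (is_derive_eq (is_derive1B (is_derive1M (dE t0) (ld t)) (is_derive1M (dy t0) qd))).
  by rewrite addr0.
- move=> t /andP[t0 tb] _.
  have [Et yt] := E_y_pos e00 t0.
  have lt0 : 0 <= l t.
    by rewrite addr_ge0 ?subr_ge0// mulr_ge0 ?(ltW t0) ?(ltW h_gt0).
  have h1 : 0 <= (xi t - l0 t) * (E t * l t).
    rewrite mulr_ge0 ?mulr_ge0 ?(ltW Et)//.
    have := xi_slope dxi Q_ge0 t0 tb; rewrite /l0; lra.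
  have h2 : 0 <= h * y t * (l t - l0 t).
    by rewrite !mulr_ge0 ?(ltW yt) ?(ltW h_gt0)// /l /l0; lra.
  rewrite /V; lra.
Qed.

End SolitonSystem.

(** * Positive definite matrices *)

Section PositiveDefinite.
Context {R : realType}.

(** Induction on the size: the Schur complement of the first entry is again
    positive definite. *)
Lemma cholesky n (A : 'M[R]_n) : A^T = A ->
  (forall v, v != 0 -> 0 < inner A v v) -> exists S : 'M[R]_n, A = S *m S^T.
Proof.
elim: n A => [A _ _|n IH A].
  by exists 0; rewrite [A]flatmx0 [RHS]flatmx0.
move: A; rewrite -[n.+1]/(1 + n)%N => A AT Apos.
set a := ulsubmx A; set b := ursubmx A; set c := dlsubmx A; set B := drsubmx A.
have EA : A = block_mx a b c B by rewrite submxK.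
have [_ cb _ BT] : [/\ a^T = a, c^T = b, b^T = c & B^T = B].
  by apply: eq_block_mx; rewrite -tr_block_mx -EA.
have bc : b^T = c by rewrite -cb trmxK.
have inE (x : 'rV[R]_1) (v : 'rV[R]_n) : inner A (row_mx x v) (row_mx x v) =
    (x *m a *m x^T + v *m c *m x^T + (x *m b *m v^T + v *m B *m v^T)) 0 0.
  rewrite /inner EA tr_row_mx mul_row_block mul_row_col !mulmxDl.
  by rewrite [LHS]mxE [RHS]mxE.
set s2 := a 0 0.
have Ea : a = s2%:M by rewrite [a]mx11_scalar.
have s2_gt0 : 0 < s2.
  have /Apos : row_mx (1%:M : 'M[R]_1) (0 : 'rV[R]_n) != 0.
    apply/eqP => /(congr1 lsubmx); rewrite row_mxKl.
    move=> /matrixP/(_ 0 0); rewrite !mxE/= => /eqP; apply/negP.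
    by rewrite oner_eq0.
  rewrite inE !mul0mx trmx0 !mulmx0 !addr0 trmx1 mulmx1 mul1mx; exact.
have s2n0 : s2 != 0 by rewrite gt_eqF.
pose s := Num.sqrt s2.
have s_gt0 : 0 < s by rewrite sqrtr_gt0.
have sn0 : s != 0 by rewrite gt_eqF.
have ss : s * s = s2 by rewrite -expr2 sqr_sqrtr// ltW.
have [||S ES] := IH (B - s2^-1 *: (c *m b)).
- by rewrite linearB/= linearZ/= trmx_mul BT cb bc.
- move=> v v0.
  pose x := - s2^-1 *: (v *m c).
  have : 0 < inner A (row_mx x v) (row_mx x v).
    apply: Apos; apply: contra v0 => /eqP /(congr1 rsubmx).
    by rewrite row_mxKr => ->; apply/eqP/matrixP => i j; rewrite !mxE.
  rewrite inE /inner Ea; congr (0 < _ 0 0).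
  have xT : x^T = - s2^-1 *: (b *m v^T).
    by rewrite /x linearZ/= trmx_mul cb.
  rewrite xT /x mulmxBr mulmxBl -!scalemxAr -!scalemxAl mul_mx_scalar -!scalemxAl.
  rewrite !scalerA !mulmxA.
  set X := v *m c *m b *m v^T; set Y := v *m B *m v^T.
  rewrite addrA -!scalerDl addrC -scaleNr.
  by congr (Y + _ *: X); field.
exists (block_mx s%:M 0 (s^-1 *: c) S).
rewrite EA tr_block_mx mulmx_block !trmx0 !mulmx0 !addr0.
congr block_mx.
- by rewrite Ea tr_scalar_mx -scalar_mxM ss.
- by rewrite linearZ/= -scalemxAr mul_scalar_mx scalerA mulVf// scale1r cb mul0mx addr0.
- by rewrite tr_scalar_mx -scalemxAl mul_mx_scalar scalerA mulVf// scale1r.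
- rewrite -ES linearZ/= -scalemxAr -scalemxAl scalerA cb.
  by rewrite -invfM ss addrC subrK.
Qed.

Lemma posdef_unitmx n (A : 'M[R]_n) :
  (forall v, v != 0 -> 0 < inner A v v) -> A \in unitmx.
Proof.
move=> Apos; rewrite -row_free_unit -kermx_eq0; apply/eqP/row_matrixP => i.
rewrite row0; apply/eqP; apply: contraT => /Apos.
by rewrite /inner -row_mul mulmx_ker row0 mul0mx mxE ltxx.
Qed.

(** Conjugating by a square root of [A] turns [A^-1 B] into a symmetric matrix,
    so the trace of its square is a sum of squares. *)
Lemma trace_sqr_ge0 n (A B : 'M[R]_n) : A^T = A ->
  (forall v, v != 0 -> 0 < inner A v v) -> B^T = B ->
  0 <= \tr ((invmx A *m B) *m (invmx A *m B)).
Proof.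
move=> AT Apos BT; have [S ES] := cholesky AT Apos.
have := posdef_unitmx Apos; rewrite ES unitmx_mul unitmx_tr andbb => Su.
have SuT : S^T \in unitmx by rewrite unitmx_tr.
have -> : invmx (S *m S^T) = invmx S^T *m invmx S.
  have U1 : invmx S^T *m invmx S *m (S *m S^T) = 1%:M.
    by rewrite -mulmxA (mulmxA (invmx S)) mulVmx// mul1mx mulVmx.
  by rewrite -[LHS]mul1mx -U1 mulmxK// unitmx_mul Su.
pose M := invmx S *m B *m invmx S^T.
have MT : M^T = M by rewrite /M !trmx_mul BT !trmx_inv trmxK mulmxA.
have -> : \tr (invmx S^T *m invmx S *m B *m (invmx S^T *m invmx S *m B)) = \tr (M *m M^T).
  by rewrite MT /M mxtrace_mulC -!mulmxA mxtrace_mulC !mulmxA.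
rewrite /mxtrace sumr_ge0// => i _; rewrite mxE sumr_ge0// => j _.
by rewrite [M^T _ _]mxE -expr2 sqr_ge0.
Qed.

(** The nonnegative trace of [trace_sqr_ge0] for [B - c A], where [c] is the mean
    of the eigenvalues of [A^-1 B]. *)
Lemma trace_sqr_le n (A B : 'M[R]_n.+1) : A^T = A ->
  (forall v, v != 0 -> 0 < inner A v v) -> B^T = B ->
  (\tr (invmx A *m B)) ^+ 2 <= n.+1%:R * \tr ((invmx A *m B) *m (invmx A *m B)).
Proof.
move=> AT Apos BT; have Au := posdef_unitmx Apos.
set X := invmx A *m B; set T := \tr X.
pose c := T / n.+1%:R.
have n0 : n.+1%:R != 0 :> R by rewrite pnatr_eq0.
have := @trace_sqr_ge0 _ A (B - c *: A) AT Apos.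
rewrite linearB/= linearZ/= AT BT => /(_ erefl).
have -> : invmx A *m (B - c *: A) = X - c%:M.
  by rewrite mulmxBr -scalemxAr mulVmx// scalemx1.
rewrite mulmxBl !mulmxBr mul_mx_scalar mul_scalar_mx -scalar_mxM.
rewrite !linearB/= !linearZ/= mxtrace_scalar -/T -[c * c *+ _]mulr_natl /GRing.scale/=.
rewrite -(ler_pM2l (_ : 0 < n.+1%:R :> R)) ?ltr0n// mulr0.
set N : R := n.+1%:R in n0 c *.
have -> : N * (\tr (X *m X) + c * - T + (c * - T - - (N * (c * c)))) =
   N * \tr (X *m X) - T ^+ 2 + 0 by rewrite /c; field.
by rewrite addr0 subr_ge0.
Qed.

End PositiveDefinite.

Lemma trace_block_inv (R : realType) n (H : 'M[R]_n) (X : 'M[R]_(1 + n)) :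
  H \in unitmx ->
  \tr (invmx (block_mx (1%:M : 'M[R]_1) 0 0 H) *m X) =
  X 0 0 + \tr (invmx H *m drsubmx X).
Proof.
move=> Hu; rewrite invmx_block_diag; last by rewrite block_diag_mx_unit unitmx1.
rewrite -{1}[X]submxK mulmx_block mxtrace_block !mul0mx addr0 add0r invmx1 mul1mx.
congr (_ + _); rewrite /mxtrace big_ord1 !mxE.
by congr (X _ _); exact: val_inj.
Qed.

(** Determinants and cofactors are polynomials in the entries, so a class of
    functions closed under the ring operations, such as the functions derivable or
    continuous at a point, is stable under them. *)

Section DetClosed.
Variables (T : Type) (R : comPzRingType) (P : (T -> R) -> Prop).
Hypothesis Pcst : forall a, P (fun=> a).
Hypothesis PD : forall f g, P f -> P g -> P (fun t => f t + g t).
Hypothesis PM : forall f g, P f -> P g -> P (fun t => f t * g t).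

Lemma sum_closed (I : Type) (s : seq I) (f : I -> T -> R) :
  (forall i, P (f i)) -> P (fun t => \sum_(i <- s) f i t).
Proof.
move=> Pf; elim: s => [|i s IH].
  by under eq_fun do rewrite big_nil; exact: Pcst.
by under eq_fun do rewrite big_cons; exact: PD.
Qed.

Lemma prod_closed (I : Type) (s : seq I) (f : I -> T -> R) :
  (forall i, P (f i)) -> P (fun t => \prod_(i <- s) f i t).
Proof.
move=> Pf; elim: s => [|i s IH].
  by under eq_fun do rewrite big_nil; exact: Pcst.
by under eq_fun do rewrite big_cons; exact: PM.
Qed.

Lemma det_closed n (A : T -> 'M[R]_n) :
  (forall i j, P (fun t => A t i j)) -> P (fun t => \det (A t)).
Proof.
by move=> PA; apply: sum_closed => s; apply: PM => //; exact: prod_closed.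
Qed.

Lemma adj_closed n (A : T -> 'M[R]_n) i j :
  (forall i j, P (fun t => A t i j)) -> P (fun t => (\adj (A t)) i j).
Proof.
move=> PA; under eq_fun do rewrite mxE; apply: PM => //; apply: det_closed => k l.
by under eq_fun do rewrite !mxE.
Qed.

End DetClosed.

Lemma derivable_invmx (R : realType) n (A : R -> 'M[R]_n) (t : R) i j :
  (forall i j, derivable (fun s => A s i j) t 1) ->
  (\forall s \near t, A s \in unitmx) ->
  derivable (fun s => (invmx (A s)) i j) t 1.
Proof.
move=> dA Au.
have detd : derivable (fun s => \det (A s)) t 1.
  apply: (@det_closed _ _ (fun f : R -> R => derivable f t 1)).
  - by move=> b; exact: derivable_cst.
  - by move=> f g; exact: derivableD.
  - by move=> f g; exact: derivableM.
  - exact: dA.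
have adjd : derivable (fun s => (\adj (A s)) i j) t 1.
  apply: (@adj_closed _ _ (fun f : R -> R => derivable f t 1)).
  - by move=> b; exact: derivable_cst.
  - by move=> f g; exact: derivableD.
  - by move=> f g; exact: derivableM.
  - exact: dA.
apply: (@near_eq_derivable _ _ _ (fun s => (\det (A s))^-1 * (\adj (A s)) i j)).
  near=> s; have As : A s \in unitmx by near: s.
  by rewrite /invmx As [RHS]mxE.
apply: derivableM; last exact: adjd.
apply: derivableV; last exact: detd.
by have := nbhs_singleton Au; rewrite unitmxE unitfE.
Unshelve. all: by end_near. Qed.

(** * Smooth maps *)

Section SmoothMaps.
Context {R : realType} {m : nat}.

Lemma smooth_differentiable (W : normedModType R) (A : set 'rV[R]_m)
    (f : 'rV[R]_m -> W) x : smooth_on A f -> A x -> differentiable f x.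
Proof. by move=> /(_ 1)[fd _]; exact: fd. Qed.

Lemma smooth_partial (W : normedModType R) (A : set 'rV[R]_m)
    (f : 'rV[R]_m -> W) i : smooth_on A f -> smooth_on A (partial i f).
Proof. by move=> fs r; have [_ fi] := fs r.+1; exact: fi. Qed.

Lemma smooth_continuous (W : normedModType R) (A : set 'rV[R]_m)
    (f : 'rV[R]_m -> W) x : smooth_on A f -> A x -> {for x, continuous f}.
Proof.
by move=> fs Ax; exact/differentiable_continuous/(smooth_differentiable fs).
Qed.

Lemma derive_partials (W : normedModType R) (f : 'rV[R]_m -> W) x v :
  differentiable f x -> 'D_v f x = \sum_i v 0 i *: partial i f x.
Proof.
move=> fx; rewrite deriveE// {1}(row_sum_delta v) linear_sum.
by apply: eq_bigr => i _; rewrite linearZ/= /partial deriveE.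
Qed.

Lemma is_derive_along (W : normedModType R) (f : 'rV[R]_m -> W)
    (gam : R -> 'rV[R]_m) (s : R) v :
  is_derive s 1 gam v -> differentiable f (gam s) ->
  is_derive s 1 (f \o gam) ('D_v f (gam s)).
Proof.
move=> gv fd; have gd : differentiable gam s by apply/derivable1_diffP/ex_derive.
have fgd : differentiable (f \o gam) s by exact: differentiable_comp.
apply: DeriveDef; first exact/derivable1_diffP.
have gv1 : 'd gam s 1 = v by rewrite -deriveE// derive_val.
by rewrite !deriveE// diff_comp//= gv1.
Qed.

Lemma differentiable_entry p q (f : 'rV[R]_m -> 'M[R]_(p, q)) x i j :
  differentiable f x -> differentiable (fun y => f y i j) x.
Proof.
move=> fx; apply: (@differentiable_comp _ _ _ _ f (fun N : 'M[R]_(p, q) => N i j)) => //.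
exact: differentiable_coord.
Qed.

Lemma partial_entry p q (f : 'rV[R]_m -> 'M[R]_(p, q)) x k i j :
  differentiable f x -> partial k (fun y => f y i j) x = partial k f x i j.
Proof.
by move=> fx; rewrite /partial derive_mx ?mxE//; exact: diff_derivable.
Qed.

Lemma is_derive_entry p q (f : R -> 'M[R]_(p, q)) (s : R) v i j :
  is_derive s 1 f v -> is_derive s 1 (fun t => f t i j) (v i j).
Proof.
move=> [fd <-]; have fdij := (@derivable_mxP _ _ _ _ f s 1).1 fd.
by rewrite derive_mx// mxE; apply: DeriveDef.
Qed.

End SmoothMaps.

(** * Changes of charts *)

Section Charts.
Context {R : realType} {m : nat} {M : topologicalType}
  {S : smooth_manifold R m M}.
Implicit Types c : chart R m M.

Lemma chart_crd c x : atlas S c -> cdom c x ->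
  ccod c (crd c x) /\ par c (crd c x) = x.
Proof. by move=> /atlas_chart[_ + _ _ _]; apply. Qed.

Lemma chart_par c y : atlas S c -> ccod c y ->
  cdom c (par c y) /\ crd c (par c y) = y.
Proof. by move=> /atlas_chart[_ _ + _ _]; apply. Qed.

Lemma nbhs_cdom c x : atlas S c -> cdom c x -> nbhs x (cdom c).
Proof. by move=> /atlas_chart[[oc _] _ _ _ _] cx; exact: open_nbhs_nbhs. Qed.

Lemma nbhs_ccod c y : atlas S c -> ccod c y -> nbhs y (ccod c).
Proof. by move=> /atlas_chart[[_ oc] _ _ _ _] cy; exact: open_nbhs_nbhs. Qed.

Lemma crd_continuous c x : atlas S c -> cdom c x -> {for x, continuous (crd c)}.
Proof. by move=> /atlas_chart[_ _ _ + _]; apply. Qed.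

Lemma par_continuous c y : atlas S c -> ccod c y -> {for y, continuous (par c)}.
Proof. by move=> /atlas_chart[_ _ _ _]; apply. Qed.

Lemma near_overlap c c' x : atlas S c -> atlas S c' -> cdom c x -> cdom c' x ->
  \forall y \near crd c x, ccod c y /\ cdom c' (par c y).
Proof.
move=> Sc Sc' cx c'x; have [cy px] := chart_crd Sc cx.
have pc := par_continuous Sc cy.
near=> y; split; near: y; first exact: nbhs_ccod.
by apply: pc; rewrite px; exact: nbhs_cdom.
Unshelve. all: by end_near. Qed.

Lemma overlap_crd c c' x : cdom c x -> cdom c' x ->
  (crd c @` (cdom c `&` cdom c')) (crd c x).
Proof. by move=> cx c'x; exists x. Qed.

Lemma transition_crd c c' x : atlas S c -> cdom c x ->
  transition c c' (crd c x) = crd c' x.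
Proof. by move=> Sc cx; rewrite /transition (chart_crd Sc cx).2. Qed.

Lemma transition_differentiable c c' x : atlas S c -> atlas S c' ->
  cdom c x -> cdom c' x -> differentiable (transition c c') (crd c x).
Proof.
move=> Sc Sc' cx c'x.
by apply: (smooth_differentiable (atlas_compatible Sc Sc')); exact: overlap_crd.
Qed.

Definition differential (u : M -> R) c (y : 'rV[R]_m) : 'rV[R]_m :=
  \row_i partial i (u \o par c) y.

Lemma differential_change (u : M -> R) c c' x : smooth_function S u ->
  atlas S c -> atlas S c' -> cdom c x -> cdom c' x ->
  differential u c (crd c x) =
  differential u c' (crd c' x) *m (jacobian (transition c c') (crd c x))^T.
Proof.
move=> us Sc Sc' cx c'x; set tau := transition c c'.
have taud := transition_differentiable Sc Sc' cx c'x.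
have ud : differentiable (u \o par c') (tau (crd c x)).
  rewrite /tau transition_crd//; apply: (smooth_differentiable (us _ Sc')).
  exact: (chart_crd Sc' c'x).1.
apply/rowP => i; rewrite !mxE /partial.
rewrite (@near_eq_derive _ _ _ _ ((u \o par c') \o tau)); last first.
  near=> y; have [cy c'y] : ccod c y /\ cdom c' (par c y).
    by near: y; exact: near_overlap.
  by rewrite /= /tau /transition (chart_crd Sc' c'y).2.
have cd : differentiable ((u \o par c') \o tau) (crd c x).
  exact: differentiable_comp.
rewrite deriveE// diff_comp//= -[X in 'd _ _ X]deriveE// -[LHS]deriveE//.
rewrite derive_partials// /tau transition_crd//.
apply: eq_bigr => j _; rewrite !mxE /partial mulrC; congr (_ * _).
by rewrite deriveE.
Unshelve. all: by end_near. Qed.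

Lemma velocity_change c c' (gam : R -> M) (s : R) v : atlas S c -> atlas S c' ->
  cdom c (gam s) -> cdom c' (gam s) -> {for s, continuous gam} ->
  is_derive s 1 (crd c \o gam) v ->
  is_derive s 1 (crd c' \o gam) (v *m jacobian (transition c c') (crd c (gam s))).
Proof.
move=> Sc Sc' cx c'x gc gv.
have taud := transition_differentiable Sc Sc' cx c'x.
rewrite -deriveEjacobian//.
apply: (@near_eq_is_derive _ _ _ (transition c c' \o (crd c \o gam))); last first.
  exact: is_derive_along.
near=> r; rewrite /= transition_crd//.
by near: r; apply: gc; exact: nbhs_cdom.
Unshelve. all: by end_near. Qed.

Context {g : metric S}.

Lemma gram_posdef c x : atlas S c -> cdom c x ->
  forall v, v != 0 -> 0 < inner (gram g c (crd c x)) v v.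
Proof. by move=> Sc cx v; apply: gram_pos => //; exact: (chart_crd Sc cx).1. Qed.

Lemma gram_symmetric c x : atlas S c -> cdom c x ->
  (gram g c (crd c x))^T = gram g c (crd c x).
Proof. by move=> Sc cx; apply: gram_sym => //; exact: (chart_crd Sc cx).1. Qed.

Lemma gram_unit c x : atlas S c -> cdom c x -> gram g c (crd c x) \in unitmx.
Proof. by move=> Sc cx; apply: posdef_unitmx; exact: gram_posdef. Qed.

(** The Gram matrices in both charts are invertible, and the Jacobian relates
    them. *)
Lemma jacobian_unit c c' x : atlas S c -> atlas S c' -> cdom c x -> cdom c' x ->
  jacobian (transition c c') (crd c x) \in unitmx.
Proof.
move=> Sc Sc' cx c'x; have := gram_unit Sc cx.
by rewrite (gram_change g Sc Sc' cx c'x) !unitmx_mul => /andP[/andP[]].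
Qed.

Lemma inner_change c c' x v w : atlas S c -> atlas S c' -> cdom c x -> cdom c' x ->
  let J := jacobian (transition c c') (crd c x) in
  inner (gram g c' (crd c' x)) (v *m J) (w *m J) =
  inner (gram g c (crd c x)) v w.
Proof.
by move=> Sc Sc' cx c'x J; rewrite /inner (gram_change g Sc Sc' cx c'x) trmx_mul !mulmxA.
Qed.

End Charts.

(** * The product chart *)

Lemma is_derive_line (R : realType) (V : normedModType R) (a v : V) (t : R) :
  is_derive t 1 (fun s => a + s *: v) v.
Proof.
have sd : is_derive t 1 (fun s => s *: v) v.
  have scd : differentiable (fun s : R => s *: v) t by exact: ex_diff.
  apply: DeriveDef; first exact/derivable1_diffP.
  by rewrite deriveE// diff_val scale1r.
have := is_deriveD (is_derive_cst a t 1) sd.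
by rewrite add0r.
Qed.

Section ProductChart.
Context {R : realType} {n k : nat} {M P : topologicalType}
  {SM : smooth_manifold R n.+1 M} {SP : smooth_manifold R n P}
  {g : metric SM} {u : M -> R} (D : cohomogeneity_one k SP g u).
Hypothesis us : smooth_function SM u.
Variables (p : P) (c0 : chart R n.+1 M) (c' : chart R n P).
Hypothesis Hc' : atlas SP c'.
Hypothesis Hc0 : atlas SM c0.
Hypothesis Hprod : product_chart (tube D) c' c0.
Hypothesis Hp : cdom c' p.

Let e0 : 'rV[R]_n.+1 := delta_mx 0 ord0.
Let pc (t : R) (q : 'rV[R]_n) : 'rV[R]_n.+1 := row_mx (t%:M : 'M[R]_(1, 1)) q.
Let y := crd c' p.
Let x0 (t : R) := pc t y.

(** [x0] is the curve normal to the hypersurfaces: [par c0 (x0 t) = tube D t p]. *)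

Lemma pc0 t q : pc t q 0 ord0 = t.
Proof.
by rewrite (_ : ord0 = lshift n (ord0 : 'I_1)) ?(row_mxEl (t%:M) q) ?mxE//; apply/val_inj.
Qed.

Lemma x0_line t : x0 t = x0 0 + t *: e0.
Proof.
apply/rowP => i; rewrite /x0 /pc !mxE.
case: splitP => j Ej.
  rewrite !mxE !ord1 (_ : (i == ord0)) ?mulr1 ?mul0rn ?add0r//.
  by apply/eqP/val_inj; rewrite /= Ej ord1.
by rewrite (_ : (i == ord0) = false) ?andbF ?mulr0 ?addr0//; apply/eqP => Ei; move: Ej; rewrite Ei.
Qed.

Lemma x0_add s t : x0 (s + t) = s *: e0 + x0 t.
Proof. by rewrite x0_line (x0_line t) scalerDl addrCA. Qed.

Lemma is_derive_x0 (t : R) : is_derive t 1 x0 e0.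
Proof. by rewrite (funext x0_line : x0 = _); exact: is_derive_line. Qed.

Lemma derive_x0 (W : normedModType R) (f : 'rV[R]_n.+1 -> W) (t : R) :
  'D_e0 f (x0 t) = 'D_1 (f \o x0) t.
Proof.
have E : (fun h : R => h^-1 *: (f (h *: e0 + x0 t) - f (x0 t))) =
    (fun h : R => h^-1 *: ((f \o x0) (h *: 1 + t) - (f \o x0) t)).
  by apply/funext => h; rewrite /= -x0_add /GRing.scale/= mulr1.
by rewrite /derive E.
Qed.

Lemma tube_cdom t : 0 < t -> cdom c0 (tube D t p).
Proof. by move=> t0; rewrite Hprod.1; exists t, p. Qed.

Lemma tube_crd t : 0 < t -> crd c0 (tube D t p) = x0 t.
Proof. by move=> t0; exact: Hprod.2. Qed.

Lemma x0_ccod t : 0 < t -> ccod c0 (x0 t).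
Proof. by move=> t0; rewrite -tube_crd//; exact: (chart_crd Hc0 (tube_cdom t0)).1. Qed.

Lemma par_x0 t : 0 < t -> par c0 (x0 t) = tube D t p.
Proof. by move=> t0; rewrite -tube_crd//; exact: (chart_crd Hc0 (tube_cdom t0)).2. Qed.

Lemma ccod_product z : ccod c0 z -> exists t q,
  [/\ 0 < t, ccod c' q, z = pc t q & par c0 z = tube D t (par c' q)].
Proof.
move=> /(chart_par Hc0)[]; rewrite {1}Hprod.1 => -[t [q [t0 q' E]]].
rewrite E Hprod.2// => Ez; exists t, (crd c' q).
by have [? ->] := chart_crd Hc' q'.
Qed.

Lemma u_product z : ccod c0 z -> (u \o par c0) z = profile D (z 0 ord0).
Proof.
move=> /ccod_product[t [q [t0 _ -> /= ->]]].
by rewrite (profile_tube D _ t0) pc0.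
Qed.

Lemma near_pos (t : R) (Q : R -> Prop) : 0 < t -> (forall s, 0 < s -> Q s) ->
  \forall s \near t, Q s.
Proof. by move=> t0 QP; near=> s; apply: QP; near: s; exact: lt_nbhsr. Unshelve. all: by end_near. Qed.

Lemma is_derive_smooth_x0 (W : normedModType R) (f : 'rV[R]_n.+1 -> W) (t : R) :
  smooth_on (ccod c0) f -> 0 < t -> is_derive t 1 (f \o x0) (partial ord0 f (x0 t)).
Proof.
move=> fs t0; apply: is_derive_along; first exact: is_derive_x0.
by apply: (smooth_differentiable fs); exact: x0_ccod.
Qed.

Lemma is_derive_profile (t : R) : 0 < t ->
  is_derive t 1 (profile D) (partial ord0 (u \o par c0) (x0 t)).
Proof.
move=> t0; apply: near_eq_is_derive (is_derive_smooth_x0 (us Hc0) t0).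
apply: near_pos => // s s0.
by rewrite /comp par_x0//; exact: profile_tube.
Qed.

Lemma is_derive_profile2 (t : R) : 0 < t ->
  is_derive t 1 (derive1 (profile D))
    (partial ord0 (partial ord0 (u \o par c0)) (x0 t)).
Proof.
move=> t0.
apply: near_eq_is_derive (is_derive_smooth_x0 (smooth_partial _ (us Hc0)) t0).
apply: near_pos => // s s0.
by rewrite derive1E; have := is_derive_profile s0 => ?; rewrite derive_val.
Qed.

(** Near the point, [u] is the profile composed with the first coordinate. *)
Lemma differential_product (t : R) : 0 < t ->
  differential u c0 (x0 t) = derive1 (profile D) t *: e0.
Proof.
move=> t0; have := is_derive_profile t0 => dphi.
have phid : differentiable (profile D) t by apply/derivable1_diffP/ex_derive.
have crdd : differentiable (fun z : 'rV[R]_n.+1 => z 0 ord0 : R) (x0 t).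
  exact: differentiable_coord.
have E0 : x0 t 0 ord0 = t by exact: pc0.
apply/rowP => i; rewrite !mxE /partial eqxx/=.
rewrite (@near_eq_derive _ _ _ _ (profile D \o (fun z : 'rV[R]_n.+1 => z 0 ord0 : R))); last first.
  near=> z; apply: u_product; near: z; exact: nbhs_ccod Hc0 (x0_ccod t0).
have cd : differentiable (profile D \o (fun z : 'rV[R]_n.+1 => z 0 ord0 : R)) (x0 t).
  by apply: differentiable_comp => //; rewrite E0.
rewrite deriveE// diff_comp//; last by rewrite E0.
rewrite E0 /= deriv1E; last exact/derivable1_diffP.
rewrite /GRing.scale/= mulrC; congr (_ * _).
rewrite -deriveE// -/(partial i _ _) (@partial_entry _ _ _ _ id)//.
by rewrite /partial derive_id !mxE eqxx/= eq_sym.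
Unshelve. all: by end_near. Qed.

Let G := gram g c0.

Lemma gram_product z : ccod c0 z ->
  G z = block_mx (1%:M : 'M[R]_(1, 1)) 0 0 (gram (hyper D (z 0 ord0)) c' (rsubmx (z : 'rV_(1 + n)))).
Proof.
move=> /ccod_product[t [q [t0 q' -> _]]].
by rewrite /G (metric_form Hc' Hc0 Hprod t0 q') pc0 row_mxKr.
Qed.

Lemma gram_x0 t : 0 < t ->
  G (x0 t) = block_mx (1%:M : 'M[R]_(1, 1)) 0 0 (gram (hyper D t) c' y).
Proof.
by move=> t0; rewrite /G (metric_form Hc' Hc0 Hprod)//; exact: (chart_crd Hc' Hp).1.
Qed.

Lemma gram_product0 z j : ccod c0 z -> G z ord0 j = (j == ord0)%:R.
Proof.
move=> cz; rewrite gram_product//; set H := gram _ _ _.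
have -> : block_mx (1%:M : 'M[R]_1) 0 0 H ord0 j = row_mx (1%:M : 'M[R]_1) 0 ord0 j.
  rewrite -(col_mxEu (row_mx (1%:M : 'M[R]_1) 0) (row_mx 0 H)).
  by congr (block_mx _ _ _ _ _ _); exact: val_inj.
rewrite [LHS]mxE; case: splitP => i Ei; rewrite mxE.
  by rewrite !ord1 eqxx (_ : j == ord0)//; apply/eqP/val_inj; rewrite /= Ei ord1.
by rewrite (_ : (j == ord0) = false)//; apply/eqP => Ej; move: Ei; rewrite Ej.
Qed.

Lemma gram_product_sym z i j : ccod c0 z -> G z i j = G z j i.
Proof. by move=> cz; rewrite /G -[in LHS](gram_sym g Hc0 cz) mxE. Qed.

Lemma partial_gram0 z i j : ccod c0 z -> partial i (fun y => G y ord0 j) z = 0.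
Proof.
move=> cz; rewrite /partial (@near_eq_derive _ _ _ _ (cst ((j == ord0)%:R : R))) ?derive_cst//.
near=> w; apply: gram_product0; near: w; exact: nbhs_ccod Hc0 cz.
Unshelve. all: by end_near. Qed.

Lemma partial_gram0' z i j : ccod c0 z -> partial i (fun y => G y j ord0) z = 0.
Proof.
move=> cz; rewrite -[RHS](partial_gram0 i j cz); apply: near_eq_derive.
near=> w; apply: gram_product_sym; near: w; exact: nbhs_ccod Hc0 cz.
Unshelve. all: by end_near. Qed.

Lemma partial_gram_sym z i j l : ccod c0 z ->
  partial i (fun y => G y j l) z = partial i (fun y => G y l j) z.
Proof.
move=> cz; apply: near_eq_derive.
near=> w; apply: gram_product_sym; near: w; exact: nbhs_ccod Hc0 cz.
Unshelve. all: by end_near. Qed.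

(** The shape operator of the hypersurfaces, extended by [0] in the direction
    of [t]. *)
Definition shape_ext z : 'M[R]_n.+1 := 2^-1 *: (invmx (G z) *m partial ord0 G z).

Lemma gram_differentiable z : ccod c0 z -> differentiable G z.
Proof. by move=> cz; exact: (smooth_differentiable (gram_smooth g Hc0)). Qed.

Lemma shape_extE z i j : ccod c0 z ->
  shape_ext z i j = 2^-1 * \sum_l invmx (G z) i l * partial ord0 (fun y => G y l j) z.
Proof.
move=> cz; rewrite !mxE; congr (_ * _); apply: eq_bigr => l _.
by rewrite partial_entry//; exact: gram_differentiable.
Qed.

(** In the next three lemmas, the first row and column of the Gram matrix are
    constant, so that only derivatives in [t] of the metric remain. *)
Lemma christoffel00 z i : ccod c0 z -> christoffel G i ord0 ord0 z = 0.
Proof.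
move=> cz; rewrite /christoffel big1 ?mulr0// => l _.
by rewrite !partial_gram0// !addr0 subr0 mulr0.
Qed.

Lemma christoffel0l z i j : ccod c0 z -> christoffel G i ord0 j z = shape_ext z i j.
Proof.
move=> cz; rewrite shape_extE// /christoffel; congr (_ * _); apply: eq_bigr => l _.
by rewrite !partial_gram0// addr0 subr0 partial_gram_sym.
Qed.

Lemma christoffel0r z i j : ccod c0 z -> christoffel G i j ord0 z = shape_ext z i j.
Proof.
move=> cz; rewrite shape_extE// /christoffel; congr (_ * _); apply: eq_bigr => l _.
by rewrite partial_gram0// partial_gram0'// add0r subr0 partial_gram_sym.
Qed.

Lemma mean_curv_shape t : 0 < t -> mean_curv D t = \tr (shape_ext (x0 t)).
Proof.
move=> t0; have cx := x0_ccod t0.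
have [cy _] := chart_crd Hc' Hp.
rewrite -(mean_curvP D t0 Hc' cy) /shape_operator /shape_ext !linearZ/=; congr (_ * _).
rewrite gram_x0//.
set H := gram (hyper D t) c' y.
have Hu : H \in unitmx.
  by apply: posdef_unitmx => v v0; exact: gram_pos.
have Gd := is_derive_smooth_x0 (gram_smooth g Hc0) t0; rewrite -/G in Gd.
set X := partial ord0 G (x0 t) in Gd *.
have -> : derive1 (fun s => gram (hyper D s) c' y) t = drsubmx (X : 'M[R]_(1 + n)).
  have hd (i j : 'I_n) : is_derive t 1 (fun s => gram (hyper D s) c' y i j)
                           (drsubmx (X : 'M[R]_(1 + n)) i j).
    rewrite !mxE.
    apply: near_eq_is_derive (is_derive_entry (rshift 1 i) (rshift 1 j) Gd).
    apply: near_pos => // s s0.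
    by rewrite /= gram_x0// (block_mxEdr (1%:M : 'M[R]_(1, 1)) 0 0 _ i j).
  apply/matrixP => i j; rewrite derive1E derive_mx.
    by rewrite mxE; have := hd i j => ?; rewrite derive_val.
  by apply/derivable_mxP => i' j'; have := hd i' j' => ?; exact: ex_derive.
rewrite (trace_block_inv X Hu) [X _ _](_ : _ = 0) ?add0r//.
have := partial_gram0 ord0 ord0 cx.
rewrite partial_entry; last exact: gram_differentiable.
by rewrite -/X => <-; congr (X _ _); exact: val_inj.
Qed.

Lemma is_derive_mean_curv (t : R) : 0 < t ->
  is_derive t 1 (mean_curv D) (\sum_i partial ord0 (fun z => shape_ext z i i) (x0 t)).
Proof.
move=> t0.
apply: (@near_eq_is_derive _ _ _ (fun s => \sum_i shape_ext (x0 s) i i)).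
  by apply: near_pos => // s s0; rewrite mean_curv_shape.
have Gs := gram_smooth g Hc0.
have dshape i : derivable (fun s => shape_ext (x0 s) i i) t 1.
  under eq_fun do rewrite !mxE.
  apply: derivableM => //.
  have -> : (fun s => \sum_j invmx (G (x0 s)) i j * partial ord0 G (x0 s) j i) =
    \sum_j (fun s => invmx (G (x0 s)) i j * partial ord0 G (x0 s) j i).
    by apply/funext => s; rewrite fct_sumE.
  apply: derivable_sum => j; apply: derivableM.
    apply: derivable_invmx => [a b|].
      by have := is_derive_entry a b (is_derive_smooth_x0 Gs t0) => ?; exact: ex_derive.
    apply: near_pos => // s s0; apply: posdef_unitmx => v v0.
    by apply: gram_pos => //; exact: x0_ccod.
  have := is_derive_entry j i (is_derive_smooth_x0 (smooth_partial ord0 Gs) t0) => ?.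
  exact: ex_derive.
have -> : (fun s => \sum_i shape_ext (x0 s) i i) = \sum_i (fun s => shape_ext (x0 s) i i).
  by apply/funext => s; rewrite fct_sumE.
apply: is_derive_eq; first by apply: is_derive_sum => i; exact: derivableP.
by apply: eq_bigr => i _; rewrite /partial derive_x0.
Qed.

(** The trace of the Riccati equation of the hypersurfaces,
    [L' + L ^ 2 = - Rm (d/dt, .) d/dt]. *)
Lemma ricci_normal t : 0 < t ->
  ricci G (x0 t) ord0 ord0 =
  - 'D_1 (mean_curv D) t - \tr (shape_ext (x0 t) *m shape_ext (x0 t)).
Proof.
move=> t0; have cx := x0_ccod t0; have := is_derive_mean_curv t0 => dT.
rewrite derive_val !mxE.
have ncx : \forall z \near x0 t, ccod c0 z by exact: nbhs_ccod Hc0 cx.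
rewrite [X in X - _ + _]big1; last first.
  move=> i _; rewrite /partial (@near_eq_derive _ _ _ _ (cst 0)) ?derive_cst//.
  by near=> z; apply: christoffel00; near: z.
rewrite sub0r; congr (- _ + _).
  apply: eq_bigr => i _; apply: near_eq_derive.
  by near=> z; apply: christoffel0r; near: z.
rewrite /mxtrace -sumrN; apply: eq_bigr => i _; rewrite mxE -sumrN.
apply: eq_bigr => j _.
by rewrite christoffel00// mulr0 sub0r christoffel0l// christoffel0r.
Unshelve. all: by end_near. Qed.

Lemma hessian_normal t : 0 < t ->
  hessian G (u \o par c0) (x0 t) ord0 ord0 = derive1n 2 (profile D) t.
Proof.
move=> t0; rewrite mxE big1 ?subr0; last first.
  by move=> i _; rewrite christoffel00 ?mul0r//; exact: x0_ccod.
rewrite derive1nS derive1n1 derive1E.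
by have := is_derive_profile2 t0 => ?; rewrite derive_val.
Qed.

End ProductChart.

(** * The Hessian along a normal curve *)

Lemma innerE (R : realType) m (A : 'M[R]_m) v w :
  inner A v w = \sum_i \sum_j v 0 i * A i j * w 0 j.
Proof.
rewrite /inner mxE exchange_big/=; apply: eq_bigr => j _.
by rewrite !mxE mulr_suml.
Qed.

Lemma innerD (R : realType) m (A B : 'M[R]_m) v w :
  inner (A + B) v w = inner A v w + inner B v w.
Proof. by rewrite /inner mulmxDr mulmxDl mxE. Qed.

Lemma innerZ (R : realType) m (A : 'M[R]_m) a v w :
  inner (a *: A) v w = a * inner A v w.
Proof. by rewrite /inner -scalemxAr -scalemxAl mxE. Qed.

Lemma inner_scale (R : realType) m (A : 'M[R]_m) a v :
  inner A (a *: v) (a *: v) = a ^+ 2 * inner A v v.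
Proof. by rewrite /inner linearZ/= -scalemxAr -!scalemxAl scalerA mxE. Qed.

Lemma is_derive1_sum (R : realType) m (f : 'I_m -> R -> R) (df : 'I_m -> R) (t : R) :
  (forall i, is_derive t 1 (f i) (df i)) ->
  is_derive t 1 (fun s => \sum_i f i s) (\sum_i df i).
Proof.
move=> fd; have -> : (fun s => \sum_i f i s) = \sum_i f i.
  by apply/funext => s; rewrite fct_sumE.
exact: is_derive_sum.
Qed.

Lemma is_derive1_ext (R : realType) (f g : R -> R) (t d d' : R) :
  is_derive t 1 f d -> (\forall s \near t, f s = g s) -> is_derive t 1 g d' ->
  d = d'.
Proof.
move=> fd fg gd; have := near_eq_is_derive fg fd.
by move=> [_ <-]; move: gd => [_ <-].
Qed.

(** Along a unit speed curve [x] whose velocity [v] is proportional to the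
    gradient of [U], with [grad U = f * v], one has [f = dU (v)].  Differentiating
    [|v|^2 = 1] expresses the contribution of the acceleration to the derivative
    of [dU (v)] by the first derivatives of the metric, exactly as the Christoffel
    symbols do; hence [f' = Hess U (v, v)].  This computes the Hessian in a chart
    without transforming Christoffel symbols between charts. *)
Lemma hessian_along (R : realType) m (G : 'rV[R]_m -> 'M[R]_m) (U : 'rV[R]_m -> R)
    (x v : R -> 'rV[R]_m) (w : 'rV[R]_m) (f : R -> R) (t : R) :
  differentiable G (x t) -> (G (x t))^T = G (x t) -> G (x t) \in unitmx ->
  (forall j, differentiable (partial j U) (x t)) ->
  is_derive t 1 x (v t) -> is_derive t 1 v w ->
  (\forall s \near t, inner (G (x s)) (v s) (v s) = 1) ->
  (\forall s \near t, \row_j partial j U (x s) = f s *: (v s *m G (x s))) ->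
  is_derive t 1 f (inner (hessian G U (x t)) (v t) (v t)).
Proof.
move=> Gd Gsym Gu Ud xd vd unit_speed dU.
pose vt := v t.
pose dG i j := \sum_l vt 0 l * partial l (fun y => G y i j) (x t).
pose K := \sum_i \sum_j vt 0 i * dG i j * vt 0 j.
pose W := \sum_i \sum_j vt 0 i * G (x t) i j * w 0 j.
pose H := \sum_i \sum_j vt 0 i * partial i (partial j U) (x t) * vt 0 j.
have vi i : is_derive t 1 (fun s => v s 0 i) (w 0 i) by exact: is_derive_entry.
have Gij i j : is_derive t 1 (fun s => G (x s) i j) (dG i j).
  have Gijd := differentiable_entry i j Gd.
  by have := is_derive_along xd Gijd; rewrite derive_partials.
have Uj j : is_derive t 1 (fun s => partial j U (x s))
    (\sum_i vt 0 i * partial i (partial j U) (x t)).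
  by have := is_derive_along xd (Ud j); rewrite derive_partials.
(* the derivative of the constant |v|^2 *)
have KW : K = - 2 * W.
  have d1 := is_derive1_sum (fun i => is_derive1_sum (fun j =>
    is_derive1M (is_derive1M (vi i) (Gij i j)) (vi j))).
  have := is_derive1_ext d1 _ (is_derive_cst (1 : R) t 1).
  have -> : \sum_i \sum_j ((w 0 i * G (x t) i j + v t 0 i * dG i j) * v t 0 j +
      v t 0 i * G (x t) i j * w 0 j) = W + K + W.
    rewrite [X in X + _ + _](_ : W = \sum_i \sum_j w 0 i * G (x t) i j * vt 0 j); last first.
      rewrite /W exchange_big/=; apply: eq_bigr => i _; apply: eq_bigr => j _.
      by rewrite -[in LHS]Gsym mxE; ring.
    rewrite -!big_split/=; apply: eq_bigr => i _; rewrite -!big_split/=.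
    by apply: eq_bigr => j _; rewrite -/vt; ring.
  move=> E; have /E : \forall s \near t,
      \sum_i \sum_j v s 0 i * G (x s) i j * v s 0 j = cst 1 s.
    by near do rewrite -innerE.
  by move=> WK; rewrite -[K](addrK W) -[K + W]addrC -[W + K](addrK W) WK; ring.
have dUt j : partial j U (x t) = f t * \sum_i vt 0 i * G (x t) i j.
  have /rowP/(_ j) := nbhs_singleton dU; rewrite !mxE => ->.
  by congr (_ * _).
have dfE : \forall s \near t, \sum_j partial j U (x s) * v s 0 j = f s.
  near=> s; transitivity (f s * inner (G (x s)) (v s) (v s)); last first.
    by rewrite (near unit_speed s)// mulr1.
  rewrite /inner mxE mulr_sumr; apply: eq_bigr => j _.
  have : \row_j partial j U (x s) = f s *: (v s *m G (x s)) by near: s.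
  move=> /rowP/(_ j); rewrite !mxE => ->.
  by rewrite mulrA.
have df := near_eq_is_derive dfE (is_derive1_sum (fun j => is_derive1M (Uj j) (vi j))).
apply: (is_derive_eq df).
have -> : \sum_i ((\sum_j vt 0 j * partial j (partial i U) (x t)) * v t 0 i
      + partial i U (x t) * w 0 i) = H + f t * W.
  rewrite big_split/=; congr (_ + _).
    by rewrite /H exchange_big/=; apply: eq_bigr => i _; rewrite mulr_suml.
  rewrite /W exchange_big mulr_sumr/=; apply: eq_bigr => j _.
  by rewrite dUt -mulrA mulr_suml.
have Gamma i j : \sum_k christoffel G k i j (x t) * partial k U (x t) =
    f t / 2 * \sum_l vt 0 l * (partial i (fun y => G y j l) (x t) +
      partial j (fun y => G y i l) (x t) - partial l (fun y => G y i j) (x t)).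
  set X := fun l => partial i (fun y => G y j l) (x t) +
    partial j (fun y => G y i l) (x t) - partial l (fun y => G y i j) (x t).
  have GV l : \sum_k (\sum_i vt 0 i * G (x t) i k) * invmx (G (x t)) k l = vt 0 l.
    have /rowP/(_ l) := mulmxK Gu vt; rewrite mxE => <-.
    by apply: eq_bigr => q _; rewrite mxE.
  transitivity (\sum_k \sum_l f t / 2 *
      ((\sum_i vt 0 i * G (x t) i k) * invmx (G (x t)) k l * X l)).
    apply: eq_bigr => q _; rewrite dUt /christoffel -mulrA mulr_suml mulr_sumr.
    by apply: eq_bigr => l _; rewrite -/(X l); field.
  rewrite exchange_big/= mulr_sumr; apply: eq_bigr => l _.
  by rewrite -mulr_sumr -mulr_suml GV.
pose T (h : 'I_m -> 'I_m -> 'I_m -> R) := \sum_i \sum_j \sum_l vt 0 i * vt 0 j * vt 0 l * h i j l.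
pose h i j l := partial i (fun y => G y j l) (x t).
have TK1 : T (fun i j l => h l i j) = K.
  rewrite /T /K; apply: eq_bigr => i _; apply: eq_bigr => j _.
  by rewrite mulr_sumr mulr_suml; apply: eq_bigr => l _; rewrite /h; ring.
have TK2 : T (fun i j l => h i j l) = K.
  rewrite -TK1 /T exchange_big/=.
  under eq_bigr => j _ do rewrite exchange_big/=.
  apply: eq_bigr => i _; apply: eq_bigr => j _.
  by apply: eq_bigr => l _; rewrite /h; ring.
have TK3 : T (fun i j l => h j i l) = K.
  rewrite -TK2 /T exchange_big/=; apply: eq_bigr => i _; apply: eq_bigr => j _.
  by apply: eq_bigr => l _; rewrite /h; ring.
rewrite innerE -/vt.
have -> : \sum_i \sum_j vt 0 i * hessian G U (x t) i j * vt 0 j =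
    H - f t / 2 * (T (fun i j l => h i j l) + T (fun i j l => h j i l) -
                   T (fun i j l => h l i j)).
  rewrite /T -big_split/= -sumrB mulr_sumr -sumrB; apply: eq_bigr => i _.
  rewrite -big_split/= -sumrB mulr_sumr -sumrB; apply: eq_bigr => j _.
  rewrite -big_split/= -sumrB mxE Gamma mulrBr mulrBl; congr (_ - _).
  rewrite !mulr_sumr mulr_suml.
  by apply: eq_bigr => l _; rewrite /h; ring.
by rewrite TK1 TK2 TK3 KW; field.
Unshelve. all: by end_near. Qed.

(** * Normal curves in an arbitrary chart *)

Lemma inner_delta (R : realType) m (A : 'M[R]_m) i j :
  inner A (delta_mx 0 i) (delta_mx 0 j) = A i j.
Proof. by rewrite /inner trmx_delta -rowE -colE !mxE. Qed.

Section TubeCurve.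
Context {R : realType} {n k : nat} {M P : topologicalType}
  {SM : smooth_manifold R n.+1 M} {SP : smooth_manifold R n P}
  {g : metric SM} {u : M -> R} (D : cohomogeneity_one k SP g u).
Hypothesis us : smooth_function SM u.

Lemma product_coords p : exists c0 c',
  [/\ atlas SP c', atlas SM c0, product_chart (tube D) c' c0 & cdom c' p].
Proof.
have [Sc' c'p] := chart_atP SP p.
by have [c0 [Sc0 pr]] := tube_chart D Sc'; exists c0, (chart_at SP p).
Qed.

Variables (p : P) (c : chart R n.+1 M).
Hypothesis Hc : atlas SM c.
Let gam (s : R) := tube D s p.

Lemma tube_continuous t : 0 < t -> {for t, continuous gam}.
Proof.
move=> t0; have [c0 [c' [Sc' Sc0 pr c'p]]] := product_coords p.
pose x0 s : 'rV[R]_n.+1 := row_mx (s%:M : 'M[R]_(1, 1)) (crd c' p).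
have x0c : {for t, continuous x0}.
  apply/differentiable_continuous/derivable1_diffP.
  by have := is_derive_x0 p c' t => ?; exact: ex_derive.
have parc : {for t, continuous (par c0 \o x0)}.
  apply: continuous_comp => //; apply: (par_continuous Sc0).
  exact: x0_ccod Sc0 pr c'p _ t0.
have E s : 0 < s -> (par c0 \o x0) s = gam s.
  by move=> s0; rewrite /= (par_x0 Sc0 pr c'p s0).
rewrite /prop_for /continuous_at -E//; apply: cvg_trans parc.
apply: near_eq_cvg; exact: near_pos.
Qed.

Lemma near_tube_cdom t : 0 < t -> cdom c (gam t) ->
  \forall s \near t, 0 < s /\ cdom c (gam s).
Proof.
move=> t0 cx; near=> s; split; near: s; first exact: lt_nbhsr.
by apply: (tube_continuous t0); exact: nbhs_cdom Hc cx.
Unshelve. all: by end_near. Qed.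

(** The normal curve has unit speed, and the gradient of [u] along it is [u'] times
    its velocity: both hold in the product chart, and are tensorial of first
    order. *)
Lemma velocity_tube t : 0 < t -> cdom c (gam t) ->
  [/\ is_derive t 1 (crd c \o gam) (velocity c gam t),
      inner (gram g c (crd c (gam t))) (velocity c gam t) (velocity c gam t) = 1,
      differential u c (crd c (gam t)) =
        derive1 (profile D) t *: (velocity c gam t *m gram g c (crd c (gam t)))
    & derivable (velocity c gam) t 1].
Proof.
move=> t0 cx; have [c0 [c' [Sc' Sc0 pr c'p]]] := product_coords p.
pose e0 : 'rV[R]_n.+1 := delta_mx 0 ord0.
pose x0 s : 'rV[R]_n.+1 := row_mx (s%:M : 'M[R]_(1, 1)) (crd c' p).
have c0x s : 0 < s -> cdom c0 (gam s) by exact: tube_cdom pr c'p s.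
have E0 s : 0 < s -> crd c0 (gam s) = x0 s by exact: tube_crd pr c'p s.
pose J s := jacobian (transition c0 c) (x0 s).
have vd s : 0 < s -> cdom c (gam s) -> is_derive s 1 (crd c \o gam) (e0 *m J s).
  move=> s0 cs; rewrite /J -(E0 _ s0); apply: (velocity_change Sc0 Hc) => //.
  - exact: c0x.
  - exact: tube_continuous.
  - apply: near_eq_is_derive (is_derive_x0 p c' s).
    by apply: near_pos => // r r0; rewrite /= E0.
have vE s : 0 < s -> cdom c (gam s) -> velocity c gam s = e0 *m J s.
  by move=> s0 cs; rewrite /velocity derive1E; have := vd _ s0 cs => ?; rewrite derive_val.
have ccx := x0_ccod Sc0 pr c'p t0.
have G00 : gram g c0 (x0 t) ord0 ord0 = 1 by rewrite (gram_product0 Sc' Sc0 pr).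
have Ju : J t \in unitmx by rewrite /J -E0//; exact: (jacobian_unit (g := g)) (c0x _ t0) cx.
have JG := gram_change g Sc0 Hc (c0x _ t0) cx; rewrite /= E0// -/(J t) in JG.
have dch := differential_change us Sc0 Hc (c0x _ t0) cx; rewrite E0// -/(J t) in dch.
rewrite vE//; split; first exact: vd.
- have := inner_change (g := g) e0 e0 Sc0 Hc (c0x _ t0) cx.
  by rewrite E0// -/(J t) => /= ->; rewrite inner_delta.
- have dpr := differential_product us Sc' Sc0 pr c'p t0.
  have JTu : (J t)^T \in unitmx by rewrite unitmx_tr.
  apply: (can_inj (mulmxK JTu)); rewrite -dch.
  rewrite -scalemxAl -!mulmxA [J t *m _]mulmxA -JG.
  rewrite [LHS]dpr; congr (_ *: _); apply/rowP => j.
  by rewrite -rowE !mxE (gram_product0 Sc' Sc0 pr)// eqxx.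
have taus := atlas_compatible Sc0 Hc.
apply: (@near_eq_derivable _ _ _ (partial ord0 (transition c0 c) \o x0)).
  near=> s; have [s0 cs] : 0 < s /\ cdom c (gam s) by near: s; exact: near_tube_cdom.
  rewrite vE// /J /= /partial deriveEjacobian//.
  by rewrite -E0//; apply: (transition_differentiable Sc0 Hc) => //; exact: c0x.
have := @is_derive_along _ _ _ (partial ord0 (transition c0 c)) x0 t _ (is_derive_x0 p c' t).
move=> /(_ _)[] //; apply: (smooth_differentiable (smooth_partial _ taus)).
by rewrite -E0//; exact: overlap_crd (c0x _ t0) cx.
Unshelve. all: by end_near. Qed.

Lemma grad_norm_tube t : 0 < t -> cdom c (gam t) ->
  grad_norm g u c (gam t) = `|derive1 (profile D) t|.
Proof.
move=> t0 cx; have [_ v1 dv _] := velocity_tube t0 cx.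
rewrite /grad_norm /vnorm /gradient -/(differential u c _) dv.
rewrite -scalemxAl mulmxK; last exact: gram_unit.
set v := velocity c gam t in v1 *; set a := derive1 _ t.
by rewrite inner_scale v1 mulr1 sqrtr_sqr.
Qed.

(** The soliton equation in the normal direction, where the Hessian of [u] is
    [u''] by [hessian_along]. *)
Lemma ricci_tube eps t : expanding_soliton g u eps -> 0 < t -> cdom c (gam t) ->
  let v := velocity c gam t in
  derive1n 2 (profile D) t + eps / 2 = - ricci_at g c (gam t) v v.
Proof.
move=> [_ _ sol] t0 cx v.
have [cd v1 dv vd] := velocity_tube t0 cx.
have [ccx _] := chart_crd Hc cx.
have Us := us Hc.
have H : is_derive t 1 (derive1 (profile D))
    (inner (hessian (gram g c) (u \o par c) (crd c (gam t))) v v).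
  apply: (@hessian_along _ _ (gram g c) (u \o par c) (crd c \o gam) (velocity c gam)
            ('D_1 (velocity c gam) t)).
  - exact: (smooth_differentiable (gram_smooth g Hc)).
  - exact: gram_symmetric.
  - exact: gram_unit.
  - by move=> j; exact: (smooth_differentiable (smooth_partial j Us)).
  - exact: derivableP.
  - near=> s; have [s0 cs] : 0 < s /\ cdom c (gam s) by near: s; exact: near_tube_cdom.
    by have [] := velocity_tube s0 cs.
  - near=> s; have [s0 cs] : 0 < s /\ cdom c (gam s) by near: s; exact: near_tube_cdom.
    by have [] := velocity_tube s0 cs.
rewrite derive1nS derive1n1 derive1E derive_val /ricci_at.
have inner0 : inner (0 : 'M[R]_n.+1) v v = 0 by rewrite /inner mulmx0 mul0mx mxE.
have := congr1 (fun A => inner A v v) (sol _ _ Hc ccx).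
rewrite /= !innerD innerZ v1 inner0; lra.
Unshelve. all: by end_near. Qed.

End TubeCurve.

(** * Rays in a chart *)

(** The integral of a nonnegative function is a supremum over the simple functions
    below it, hence monotone. *)
Lemma ge0_integral_le_cst (R : realType) (f : R -> R) (K : R) :
  (forall x, 0 <= x <= 1 -> 0 <= f x <= K) ->
  (\int[lebesgue_measure]_(x in `[0%R, 1%R]) (f x)%:E <= K%:E)%E.
Proof.
move=> fK.
have -> : K%:E = (\int[lebesgue_measure]_(x in `[0%R, 1%R]) (K%:E : \bar R))%E.
  rewrite integral_cst//= lebesgue_measure_itv/= lte_fin ltr01.
  by rewrite -EFinB subr0 mule1.
have mem01 (x : R) : `[0, 1]%classic x -> 0 <= x <= 1 by rewrite /= in_itv.
have K0 : 0 <= K by have /andP[f0 fK0] := fK 0 ltac:(by rewrite lexx ler01); exact: le_trans fK0.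
rewrite !ge0_integralE/=; last 2 first.
- by move=> x _; rewrite lee_fin.
- by move=> x /mem01/fK /andP[f0 _]; rewrite lee_fin.
apply: ge_ereal_sup => _ [h/= hf] <-; apply: le_ereal_sup_tmp.
eexists; last exact: lexx.
exists h => //= x.
apply: (le_trans (hf x)); rewrite /patch; case: ifPn => // /set_mem/mem01/fK/andP[_ ?].
by rewrite lee_fin.
Qed.

Lemma line_continuous (R : realType) (V : normedModType R) (a w : V) (r : R) :
  {for r, continuous (fun r : R => a + r *: w)}.
Proof.
apply/differentiable_continuous/derivable1_diffP.
by have := is_derive_line a w r => ?; exact: ex_derive.
Qed.

Lemma continuous_bigsum (R : numFieldType) (T : topologicalType) (V : normedModType R)
    (I : Type) (s : seq I) (f : I -> T -> V) (x : T) :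
  (forall i, {for x, continuous (f i)}) ->
  {for x, continuous (fun t => \sum_(i <- s) f i t)}.
Proof.
move=> fc; rewrite /prop_for /continuous_at; elim: s => [|i s IH].
  by under eq_fun do rewrite big_nil; rewrite big_nil; exact: cvg_cst.
under eq_fun do rewrite big_cons; rewrite big_cons.
by apply: cvgD => //; exact: fc.
Qed.

Section ChartSegment.
Context {R : realType} {m : nat} {M : topologicalType}
  {S : smooth_manifold R m M} {g : metric S}.
Variables (c : chart R m M) (a w : 'rV[R]_m).
Hypothesis Sc : atlas S c.
Let line (r : R) := a + r *: w.
Let gam r := par c (line r).

Lemma segment_continuous r : ccod c (line r) -> {for r, continuous gam}.
Proof.
move=> cr; apply: (@continuous_comp _ _ _ line (par c)).
  exact: line_continuous.
exact: par_continuous Sc cr.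
Qed.

Lemma near_segment r : ccod c (line r) -> \forall s \near r, ccod c (line s).
Proof. by move=> cr; apply: line_continuous; exact: nbhs_ccod Sc cr. Qed.

Lemma segment_velocity c2 r : atlas S c2 -> ccod c (line r) -> cdom c2 (gam r) ->
  is_derive r 1 (crd c2 \o gam) (w *m jacobian (transition c c2) (line r)).
Proof.
move=> Sc2 cr c2r; have [cg cgE] := chart_par Sc cr.
rewrite -[in X in _ *m X]cgE; apply: (velocity_change Sc Sc2) => //.
  exact: segment_continuous.
apply: near_eq_is_derive (is_derive_line a w r).
near=> s; have cs : ccod c (line s) by near: s; exact: near_segment.
by rewrite /= (chart_par Sc cs).2.
Unshelve. all: by end_near. Qed.

Lemma segment_C1 r : ccod c (line r) -> C1_at S gam r.
Proof.
move=> cr; split; first exact: segment_continuous.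
move=> c2 Sc2 c2r.
have near2 : \forall s \near r, ccod c (line s) /\ cdom c2 (gam s).
  near=> s; split; near: s; first exact: near_segment.
  by apply: (segment_continuous cr); exact: nbhs_cdom Sc2 c2r.
split.
  near=> s; have [cs c2s] : ccod c (line s) /\ cdom c2 (gam s) by near: s.
  by have := segment_velocity Sc2 cs c2s => ?; exact: ex_derive.
have taus := atlas_compatible Sc Sc2.
have mem s : ccod c (line s) -> cdom c2 (gam s) ->
    (crd c @` (cdom c `&` cdom c2)) (line s).
  move=> cs c2s; have [cg cgE] := chart_par Sc cs; rewrite -cgE; exact: overlap_crd.
pose V s := \sum_i w 0 i *: partial i (transition c c2) (line s).
have VE : \forall s \near r, V s = velocity c2 gam s.
  near=> s; have [cs c2s] : ccod c (line s) /\ cdom c2 (gam s) by near: s.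
  rewrite /velocity derive1E; have := segment_velocity Sc2 cs c2s => ?.
  have td : differentiable (transition c c2) (line s).
    by apply: (smooth_differentiable taus); exact: mem.
  by rewrite derive_val -deriveEjacobian// derive_partials.
have Vc : {for r, continuous V}.
  apply: continuous_bigsum => i; apply: cvgZl_tmp.
  apply: (@continuous_comp _ _ _ line (partial i (transition c c2))).
    exact: line_continuous.
  by apply: (smooth_continuous (smooth_partial i taus)); exact: mem.
rewrite /prop_for /continuous_at -(nbhs_singleton VE); apply: cvg_trans Vc.
exact: near_eq_cvg.
Unshelve. all: by end_near. Qed.

Lemma segment_speed r : ccod c (line r) ->
  speed g gam r = vnorm (gram g c (line r)) w.
Proof.
move=> cr; have [cg cgE] := chart_par Sc cr.
have [Sc2 c2r] := chart_atP S (gam r); rewrite /speed /velocity derive1E.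
have := segment_velocity Sc2 cr c2r => ?; rewrite derive_val /vnorm.
have := inner_change (g := g) w w Sc Sc2 cg c2r.
by rewrite cgE => /= ->.
Qed.

Lemma segment_dist_le (K : R) :
  (forall r, 0 <= r <= 1 -> ccod c (line r) /\ vnorm (gram g c (line r)) w <= K) ->
  (riem_dist g (gam 0) (gam 1) <= K%:E)%E.
Proof.
move=> cK; apply: (@le_trans _ _ (curve_length g gam)).
  apply: ereal_inf_lbound; exists gam => //; split => // r r01.
  by apply: segment_C1; have [] := cK r r01.
apply: ge0_integral_le_cst => r /cK[cr rK].
by rewrite segment_speed// sqrtr_ge0.
Qed.

End ChartSegment.

(** The length of the straight segment bounds the distance, and the Gram matrix is
    bounded near the base point. *)
Lemma ray_dist_le (R : realType) m (M : topologicalType)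
    (S : smooth_manifold R m M) (g : metric S) c q (v : 'rV[R]_m) :
  atlas S c -> cdom c q ->
  exists K d : R, [/\ 0 < K, 0 < d & forall s, 0 <= s <= d ->
    ccod c (crd c q + s *: v) /\
    (riem_dist g q (par c (crd c q + s *: v)) <= (K * s)%:E)%E].
Proof.
move=> Sc cq; have [cy yq] := chart_crd Sc cq; set y := crd c q in cy yq *.
pose f (z : 'rV[R]_m) := inner (gram g c z) v v.
have fc : {for y, continuous f}.
  have Gij i j : {for y, continuous (fun z => gram g c z i j)}.
    apply/differentiable_continuous/differentiable_entry.
    exact: (smooth_differentiable (gram_smooth g Sc)).
  have -> : f = fun z => \sum_i \sum_j v 0 i * gram g c z i j * v 0 j.
    by apply/funext => z; rewrite /f innerE.
  apply: continuous_bigsum => i; apply: continuous_bigsum => j.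
  exact: (cvgM (cvgM (cvg_cst (v 0 i)) (Gij i j)) (cvg_cst (v 0 j))).
pose B := `|f y| + 1; have B0 : 0 < B by rewrite ltr_wpDl.
have fB : nbhs (f y) [set z | z < B].
  by apply: lt_nbhsl; rewrite (le_lt_trans (ler_norm _))// ltrDl.
have nearB : \forall z \near y, ccod c z /\ f z < B.
  near=> z; split; near: z; first exact: nbhs_ccod Sc cy.
  exact: (fc _ fB).
have : \forall s \near (0 : R), ccod c (y + s *: v) /\ f (y + s *: v) < B.
  have lc := @line_continuous R _ y v 0; rewrite /prop_for /continuous_at in lc.
  rewrite scale0r addr0 in lc; exact: (lc _ nearB).
move=> /nbhs_ballP[e /= e0 be]; exists (Num.sqrt B), (e / 2).
rewrite sqrtr_gt0 B0 divr_gt0//; split => // s /andP[s0 se].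
have H r : 0 <= r <= 1 -> ccod c (y + r *: (s *: v)) /\ f (y + r *: (s *: v)) < B.
  move=> /andP[r0 r1]; rewrite scalerA; apply: be; rewrite /ball/= sub0r normrN.
  rewrite ger0_norm ?mulr_ge0//.
  have : r * s <= 1 * s by rewrite ler_wpM2r.
  lra.
have [c1 _] := H 1 ltac:(by rewrite ler01 lexx); rewrite scale1r in c1; split => //.
have := @segment_dist_le R m M S g c y (s *: v) Sc (Num.sqrt B * s).
rewrite scale0r addr0 scale1r yq; apply => r /H[cr fr]; split => //.
rewrite /vnorm inner_scale sqrtrM ?sqr_ge0// sqrtr_sqr ger0_norm// mulrC.
by rewrite ler_wpM2r// ler_wsqrtr// ltW.
Unshelve. all: by end_near. Qed.

(** * The special orbit *)

Section NearOrbit.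
Context {R : realType} {n k : nat} {M P : topologicalType}
  {SM : smooth_manifold R n.+1 M} {SP : smooth_manifold R n P}
  {g : metric SM} {u : M -> R} (D : cohomogeneity_one k SP g u).
Hypothesis us : smooth_function SM u.

Lemma principal_nonempty : exists p : P, True.
Proof.
apply: contrapT => nP; apply: (M_noncompact D).
have -> : [set: M] = Defs.orbit D; last exact: orbit_compact.
apply/seteqP; split => // x _; apply: contrapT => /(tube_image D)[t [p _]].
by apply: nP; exists p.
Qed.

Lemma orbit_nonempty : exists q, Defs.orbit D q.
Proof.
have [p _] := principal_nonempty.
apply: contrapT => nO; have := tube_dist D p (ltr01 : (0 : R) < 1).
rewrite /dist_to (_ : Defs.orbit D = set0); last first.
  by apply/seteqP; split => // q Oq; apply: nO; exists q.
by rewrite image_set0 ereal_inf0.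
Qed.

(** As [t] is the distance to the orbit, it tends to [0] along a ray leaving
    the orbit, so by continuity it takes every small value there. *)
Lemma ray_meets_hypersurfaces c q (v : 'rV[R]_n.+1) (d0 : R) :
  atlas SM c -> cdom c q -> Defs.orbit D q -> 0 < d0 ->
  (forall s, 0 < s <= d0 -> ccod c (crd c q + s *: v) ->
     ~ Defs.orbit D (par c (crd c q + s *: v))) ->
  forall d : R, 0 < d -> exists2 t0 : R, 0 < t0 & forall t, 0 < t < t0 ->
    exists s p, [/\ 0 < s < d, ccod c (crd c q + s *: v)
                 & par c (crd c q + s *: v) = tube D t p].
Proof.
move=> Sc cq Oq d00 offO d d_gt0.
have [K [d1 [K0 d10 ray]]] := ray_dist_le g v Sc cq.
pose line s := crd c q + s *: v.
pose d2 := Num.min d0 d1.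
have d2_gt0 : 0 < d2 by rewrite lt_min d00.
have d20 : d2 <= d0 by rewrite ge_min lexx.
have d21 : d2 <= d1 by rewrite ge_min lexx orbT.
have cl s : 0 < s <= d2 -> ccod c (line s).
  by move=> /andP[s0 sd]; have [] // := ray s; rewrite (ltW s0) (le_trans sd d21).
have /choice[tau tauP] : forall s, exists t : R, 0 < s <= d2 ->
    0 < t /\ exists p, par c (line s) = tube D t p.
  move=> s; have [sd|nsd] := pselect (0 < s <= d2); last by exists 0.
  have /(tube_image D)[t [p [t0 E]]] : ~ Defs.orbit D (par c (line s)).
    apply: offO; last exact: cl.
    by move: sd => /andP[-> /le_trans->].
  by exists t => _; split => //; exists p.
have tauK s : 0 < s <= d2 -> tau s <= K * s.
  move=> sd; have [t0 [p E]] := tauP s sd.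
  rewrite -lee_fin -(tube_dist D p t0) -E.
  have [|_] := ray s.
    by move: sd => /andP[/ltW-> sd]; rewrite (le_trans sd).
  apply: le_trans; apply: ereal_inf_lbound.
  by exists q.
have tauc s : 0 < s < d2 -> {for s, continuous tau}.
  move=> /andP[s0 sd].
  have ssd : 0 < s <= d2 by rewrite s0 ltW.
  have [t0 [p E]] := tauP s ssd.
  have [c1 [c' [Sc' Sc1 pr c'p]]] := product_coords D p.
  have c1x : cdom c1 (par c (line s)) by rewrite E; exact: tube_cdom pr c'p _ t0.
  pose f r := crd c1 (par c (line r)) 0 ord0.
  have linec : {for s, continuous (fun r => par c (line r))}.
    exact: (@segment_continuous R _ M SM c (crd c q) v Sc s (cl _ ssd)).
  have fc : {for s, continuous f}.
    apply: (@continuous_comp _ _ _ (fun r => crd c1 (par c (line r)))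
              (fun z : 'rV[R]_n.+1 => z 0 ord0)).
      apply: (@continuous_comp _ _ _ (fun r => par c (line r)) (crd c1)).
        exact: linec.
      exact: crd_continuous Sc1 c1x.
    exact/differentiable_continuous/differentiable_coord.
  have ftau r : 0 < r <= d2 -> cdom c1 (par c (line r)) -> f r = tau r.
    move=> rd; rewrite {1}pr.1 => -[t' [p' [t'0 c'p' E']]].
    have [tr [pr' Er]] := tauP r rd.
    have [-> _] := tube_inj tr t'0 (etrans (esym Er) E').
    by rewrite /f E' pr.2// pc0.
  have nearE : \forall r \near s, f r = tau r.
    near=> r; apply: ftau.
      by apply/andP; split; [|apply: ltW]; near: r; [exact: lt_nbhsr|exact: lt_nbhsl].
    by near: r; apply: linec; exact: nbhs_cdom Sc1 c1x.
  rewrite /prop_for /continuous_at -ftau//; apply: cvg_trans fc.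
  exact: near_eq_cvg.
pose s2 := Num.min d d2 / 2.
have m0 : 0 < Num.min d d2 by rewrite lt_min d_gt0.
have s20 : 0 < s2 by rewrite divr_gt0.
have s2d : s2 < d.
  have : Num.min d d2 <= d by rewrite ge_min lexx.
  by rewrite /s2; lra.
have s2d2 : s2 < d2.
  have : Num.min d d2 <= d2 by rewrite ge_min lexx orbT.
  by rewrite /s2; lra.
have s2in : 0 < s2 <= d2 by rewrite s20 ltW.
exists (tau s2); first by have [] := tauP s2 s2in.
move=> t /andP[t0 tt2].
pose s1 := Num.min s2 (t / K).
have s10 : 0 < s1 by rewrite lt_min s20 divr_gt0.
have s12 : s1 <= s2 by rewrite ge_min lexx.
have t1t : tau s1 <= t.
  have s1in : 0 < s1 <= d2 by rewrite s10 (le_trans s12)// ltW.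
  apply: (le_trans (tauK _ s1in)).
  by rewrite mulrC -ler_pdivlMr// ge_min lexx orbT.
have [||s] := @IVT R tau s1 s2 t s12.
- apply: continuous_in_subspaceT => s /set_mem/=; rewrite in_itv/= => /andP[ss1 ss2].
  by apply: tauc; rewrite (lt_le_trans s10 ss1) (le_lt_trans ss2 s2d2).
- by rewrite ge_min t1t le_max (ltW tt2) orbT.
rewrite in_itv/= => /andP[ss1 ss2] Et.
have sin : 0 < s <= d2 by rewrite (lt_le_trans s10 ss1) (le_trans ss2)// ltW.
have [_ [p E]] := tauP s sin; exists s, p; split.
- by rewrite (lt_le_trans s10 ss1) (le_lt_trans ss2).
- exact: cl.
- by rewrite E Et.
Unshelve. all: by end_near. Qed.

Hypothesis normalized : profile D 0 = 0.

(** The codimension is positive, so in an adapted chart the first coordinate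
    vanishes on the orbit and its axis leaves the orbit at once. *)
Lemma orbit_chart : exists c q, [/\ atlas SM c, cdom c q, Defs.orbit D q &
  forall s, s != 0 -> ccod c (crd c q + s *: delta_mx 0 ord0) ->
    ~ Defs.orbit D (par c (crd c q + s *: delta_mx 0 ord0))].
Proof.
have [q Oq] := orbit_nonempty; have [_ /(_ q Oq)] := orbit_submanifold D.
move=> [c [Sc cq Oc]]; exists c, q; split => // s s0 cs.
have [cp cpE] := chart_par Sc cs.
move=> /(Oc _ cp)/(_ ord0 isT); rewrite cpE !mxE eqxx/= mulr1.
by rewrite ((Oc q cq).1 Oq ord0 isT) add0r => /eqP; apply/negP.
Qed.

Lemma u_orbit q : Defs.orbit D q -> u q = 0.
Proof. by move=> Oq; rewrite (profile_orbit Oq). Qed.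

(** Otherwise [u] would be positive on one ray and negative on the opposite
    one, while both rays meet every hypersurface close to the orbit. *)
Lemma differential_orbit c q : atlas SM c -> cdom c q -> Defs.orbit D q ->
  differential u c (crd c q) = 0.
Proof.
move=> Sc cq Oq; apply: contrapT => du0.
have [cy yq] := chart_crd Sc cq.
set y := crd c q in cy yq du0 *.
pose U := u \o par c; pose v := differential u c y.
have Ud : differentiable U y by exact: smooth_differentiable (us Sc) cy.
pose L := 'D_v U y.
have L0 : 0 < L.
  rewrite /L derive_partials//.
  have E i : v 0 i *: partial i U y = v 0 i ^+ 2 by rewrite !mxE expr2.
  under eq_bigr do rewrite E.
  rewrite lt_neqAle sumr_ge0 ?andbT; last by move=> i _; exact: sqr_ge0.
  apply/eqP => /esym/eqP; rewrite psumr_eq0; last by move=> i _; exact: sqr_ge0.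
  move=> /allP v0; apply: du0; apply/rowP => i.
  have := v0 i (mem_index_enum i); rewrite sqrf_eq0 => /eqP E0.
  by rewrite -/v E0 [RHS]mxE.
have Uy : U y = 0 by rewrite /U/= yq u_orbit.
have dline (sg : R) : is_derive (0 : R) 1 (fun s : R => U (y + s *: (sg *: v))) (sg * L).
  have Ud' : differentiable U (y + 0 *: (sg *: v)) by rewrite scale0r addr0.
  have := is_derive_along (is_derive_line y (sg *: v) 0) Ud'.
  by rewrite scale0r addr0 deriveE// linearZ/= -deriveE.
have sgnU (sg : R) : sg ^+ 2 = 1 -> exists2 t0 : R, 0 < t0 &
    forall t, 0 < t < t0 -> 0 < sg * profile D t.
  move=> sg2.
  have : exists2 d, 0 < d & forall s, 0 < s <= d -> 0 < sg * U (y + s *: (sg *: v)).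
    have := is_derive1M (is_derive_cst (sg : R) (0 : R) 1) (dline sg).
    rewrite mul0r add0r /= mulrA -expr2 sg2 mul1r => -[fd fE].
    have fd' : (fun h => h^-1 *: (sg * U (y + (h *: 1 + 0) *: (sg *: v)) -
        sg * U (y + 0 *: (sg *: v)))) @ (0:R)^' --> L.
      by rewrite -fE; exact: fd.
    have /fd' : nbhs L [set z : R | 0 < z] by exact: lt_nbhsr.
    move=> /nbhs_ballP[e /= e0 be]; exists (e / 2); first by rewrite divr_gt0.
    move=> s /andP[s0 se].
    have := be s; rewrite /ball/= sub0r normrN gtr0_norm// => /(_ _ _).
    rewrite scale0r !addr0 Uy mulr0 subr0 /GRing.scale/= mulr1.
    move=> H; have : 0 < s^-1 * (sg * U (y + s *: (sg *: v))).
      by apply: H; [lra|rewrite gt_eqF].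
    by rewrite pmulr_rgt0// invr_gt0.
  move=> [d d0 Upos].
  have offO s : 0 < s <= d -> ccod c (y + s *: (sg *: v)) ->
      ~ Defs.orbit D (par c (y + s *: (sg *: v))).
    by move=> sd _ /u_orbit E; have := Upos s sd; rewrite /U/= E mulr0 ltxx.
  have [t0 t00 H] := ray_meets_hypersurfaces Sc cq Oq d0 offO d0.
  exists t0 => // t tt0; have [s [p [/andP[s0 sd] _ E]]] := H t tt0.
  have := Upos s; rewrite s0 ltW// => /(_ isT).
  by rewrite /U/= E (profile_tube D)//; move: tt0 => /andP[].
have [tp tp0 Hp] := sgnU 1 ltac:(by rewrite expr1n).
have [tn tn0 Hn] := sgnU (- 1) ltac:(by rewrite sqrrN expr1n).
pose t := Num.min tp tn / 2.
have m0 : 0 < Num.min tp tn by rewrite lt_min tp0.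
have mp : Num.min tp tn <= tp by rewrite ge_min lexx.
have mn : Num.min tp tn <= tn by rewrite ge_min lexx orbT.
have tltp : 0 < t < tp by rewrite /t; apply/andP; split; lra.
have tltn : 0 < t < tn by rewrite /t; apply/andP; split; lra.
by have := Hp t tltp; have := Hn t tltn; lra.
Qed.

Lemma profile_lim : profile D t @[t --> 0^'+] --> (0 : R).
Proof.
have [c [q [Sc cq Oq off]]] := orbit_chart; have [cy yq] := chart_crd Sc cq.
set y := crd c q in cy yq off *.
pose U := u \o par c.
have Uy : U y = 0 by rewrite /U/= yq u_orbit.
have Uc : {for y, continuous U} by exact: smooth_continuous (us Sc) cy.
apply/cvgrPdist_lt => e e0.
have lineU : \forall s \near (0 : R), `|U (y + s *: delta_mx 0 ord0)| < e.
  have lc := @line_continuous R _ y (delta_mx 0 ord0) 0.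
  rewrite /prop_for /continuous_at scale0r addr0 in lc.
  have nU : \forall z \near y, `|U z| < e.
    have /cvgrPdist_lt/(_ e e0) := Uc; rewrite Uy.
    by apply: filterS => z; rewrite sub0r normrN.
  exact: (lc _ nU).
move: lineU => /nbhs_ballP[d /= d0 bd].
have off1 (s : R) : 0 < s <= 1 -> ccod c (y + s *: delta_mx 0 ord0) ->
    ~ Defs.orbit D (par c (y + s *: delta_mx 0 ord0)).
  by move=> /andP[s0 _]; apply: off; rewrite gt_eqF.
have [t0 t00 H] := ray_meets_hypersurfaces Sc cq Oq ltr01 off1 d0.
near=> t; have tt0 : 0 < t < t0.
  by apply/andP; split; near: t; [exact: nbhs_right_gt|exact: nbhs_right_lt].
have [s [p [/andP[s0 sd] _ E]]] := H t tt0.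
have := bd s; rewrite /ball/= !sub0r !normrN gtr0_norm// => /(_ sd).
by rewrite /U/= E (profile_tube D)//; move: tt0 => /andP[].
Unshelve. all: by end_near. Qed.

(** [phi' ^ 2] is the squared norm of [du], that is [du * adj G * du^T / det G] by
    Cramer's rule; this is continuous, and [du] vanishes on the orbit. *)
Lemma profile_derivative_lim : derive1 (profile D) t @[t --> 0^'+] --> (0 : R).
Proof.
have [c [q [Sc cq Oq off]]] := orbit_chart; have [cy yq] := chart_crd Sc cq.
have dU0 := differential_orbit Sc cq Oq.
have Gu := gram_unit (g := g) Sc cq.
set y := crd c q in cy yq off dU0 Gu *.
pose alpha z := differential u c z.
pose N z := \sum_i \sum_j alpha z 0 i * (\adj (gram g c z)) i j * alpha z 0 j.
pose r z := N z / \det (gram g c z).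
have ac i : {for y, continuous (fun z => alpha z 0 i)}.
  have -> : (fun z => alpha z 0 i) = partial i (u \o par c).
    by apply/funext => z; rewrite mxE.
  exact: smooth_continuous (smooth_partial i (us Sc)) cy.
have Gij i j : {for y, continuous (fun z => gram g c z i j)}.
  apply/differentiable_continuous/differentiable_entry.
  exact: (smooth_differentiable (gram_smooth g Sc)).
have adjc i j : {for y, continuous (fun z => (\adj (gram g c z)) i j)}.
  apply: (@adj_closed _ _ (fun f : 'rV[R]_n.+1 -> R => {for y, continuous f})) => //.
  - by move=> b; exact: cst_continuous.
  - by move=> f1 f2; exact: continuousD.
  - by move=> f1 f2; exact: continuousM.
have detc : {for y, continuous (fun z => \det (gram g c z))}.
  apply: (@det_closed _ _ (fun f : 'rV[R]_n.+1 -> R => {for y, continuous f})) => //.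
  - by move=> b; exact: cst_continuous.
  - by move=> f1 f2; exact: continuousD.
  - by move=> f1 f2; exact: continuousM.
have rc : {for y, continuous r}.
  apply: continuousM.
    apply: continuous_bigsum => i; apply: continuous_bigsum => j.
    exact: (cvgM (cvgM (ac i) (adjc i j)) (ac j)).
  by apply: continuousV => //; move: Gu; rewrite unitmxE unitfE.
have ry : r y = 0.
  rewrite /r /N big1 ?mul0r// => i _; rewrite big1// => j _.
  by rewrite /alpha dU0 mxE !mul0r.
have sq t p : 0 < t -> cdom c (tube D t p) ->
    derive1 (profile D) t ^+ 2 = r (crd c (tube D t p)).
  move=> t0 cx; have [_ v1 dv _] := velocity_tube us Sc t0 cx.
  have Gu' := gram_unit (g := g) Sc cx.
  set z := crd c _ in v1 dv Gu' *; set v := velocity _ _ _ in v1 dv *.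
  set a := derive1 _ _ in dv *.
  rewrite /r; have -> : N z / \det (gram g c z) = inner (invmx (gram g c z)) (alpha z) (alpha z).
    rewrite /invmx Gu' innerZ mulrC; congr (_ * _).
    by rewrite innerE.
  rewrite /alpha dv inner_scale -[LHS]mulr1; congr (_ * _).
  rewrite /inner mulmxK// trmx_mul mulmxA (gram_symmetric Sc cx).
  by rewrite -v1 /inner.
apply/cvgrPdist_lt => e e0.
have liner : \forall s \near (0 : R), `|r (y + s *: delta_mx 0 ord0)| < e ^+ 2.
  have lc := @line_continuous R _ y (delta_mx 0 ord0) 0.
  rewrite /prop_for /continuous_at scale0r addr0 in lc.
  have nr : \forall z \near y, `|r z| < e ^+ 2.
    have /cvgrPdist_lt/(_ (e ^+ 2) (exprn_gt0 2 e0)) := rc; rewrite ry.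
    by apply: filterS => z; rewrite sub0r normrN.
  exact: (lc _ nr).
move: liner => /nbhs_ballP[d /= d0 bd].
have off1 (s : R) : 0 < s <= 1 -> ccod c (y + s *: delta_mx 0 ord0) ->
    ~ Defs.orbit D (par c (y + s *: delta_mx 0 ord0)).
  by move=> /andP[s0 _]; apply: off; rewrite gt_eqF.
have [t0 t00 H] := ray_meets_hypersurfaces Sc cq Oq ltr01 off1 d0.
near=> t; have tt0 : 0 < t < t0.
  by apply/andP; split; near: t; [exact: nbhs_right_gt|exact: nbhs_right_lt].
have [s [p [/andP[s0 sd] cs E]]] := H t tt0.
have [tp _] := andP tt0.
have [cp cpE] := chart_par Sc cs.
have := bd s; rewrite /ball/= !sub0r !normrN gtr0_norm// => /(_ sd).
rewrite -cpE E -sq//; last by rewrite -E.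
rewrite ger0_norm ?sqr_ge0// -real_normK ?num_real//.
by rewrite ltr_pXn2r// nnegrE ltW.
Unshelve. all: by end_near. Qed.

End NearOrbit.

(** * The traced Riccati equation *)

Section TracedRiccati.
Context {R : realType} {n k : nat} {M P : topologicalType}
  {SM : smooth_manifold R n.+1 M} {SP : smooth_manifold R n P}
  {g : metric SM} {u : M -> R} (D : cohomogeneity_one k SP g u) (eps : R).
Hypothesis soliton : expanding_soliton g u eps.

(** The soliton equation gives [Ric (d/dt, d/dt) = - u'' - eps / 2] in the traced
    Riccati equation.  The trace inequality has the dimension [n.+1] of the shape
    operator extended by [0]. *)
Lemma traced_riccati : exists Q : R -> R, forall t : R, 0 < t ->
  [/\ is_derive t 1 (mean_curv D) (derive1n 2 (profile D) t + eps / 2 - Q t),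
      0 <= Q t & mean_curv D t ^+ 2 <= n.+1%:R * Q t].
Proof.
have [_ us sol] := soliton.
have [p _] := principal_nonempty D.
have [c0 [c' [Sc' Sc0 pr c'p]]] := product_coords D p.
pose x0 s : 'rV[R]_n.+1 := row_mx (s%:M : 'M[R]_(1, 1)) (crd c' p).
pose A s := shape_ext (g := g) c0 (x0 s).
exists (fun s => \tr (A s *m A s)) => t t0.
have cx := x0_ccod Sc0 pr c'p t0.
have G00 : gram g c0 (x0 t) ord0 ord0 = 1 by rewrite (gram_product0 Sc' Sc0 pr).
split.
- have dT := is_derive_mean_curv Sc' Sc0 pr c'p t0.
  apply: (is_derive_eq dT).
  have := congr1 (fun B : 'M[R]_n.+1 => B ord0 ord0) (sol _ _ Sc0 cx).
  rewrite /= [LHS]mxE [X in X + _]mxE (ricci_normal Sc' Sc0 pr c'p t0).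
  rewrite (hessian_normal us Sc' Sc0 pr c'p t0) derive_val.
  rewrite [X in _ + X = _]mxE G00 [RHS]mxE.
  set S := (X in - X - _ + _ + _ = _); set T := (X in - _ - X + _ + _ = _) => H.
  by rewrite -[LHS]/S -[RHS]/(derive1n 2 (profile D) t + eps / 2 - T); lra.
- rewrite /A /shape_ext scalemxAr; apply: trace_sqr_ge0.
  + exact: gram_sym Sc0 cx.
  + by move=> v v0; exact: gram_pos Sc0 cx v0.
  + apply/matrixP => i j; rewrite !mxE; congr (_ * _).
    have Gd := gram_differentiable (g := g) Sc0 cx.
    by rewrite -!partial_entry// (partial_gram_sym Sc0 _ _ _ cx).
- rewrite (mean_curv_shape Sc' Sc0 pr c'p t0) /A /shape_ext scalemxAr.
  apply: trace_sqr_le.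
  + exact: gram_sym Sc0 cx.
  + by move=> v v0; exact: gram_pos Sc0 cx v0.
  + apply/matrixP => i j; rewrite !mxE; congr (_ * _).
    have Gd := gram_differentiable (g := g) Sc0 cx.
    by rewrite -!partial_entry// (partial_gram_sym Sc0 _ _ _ cx).
Qed.

Lemma einstein_of_zero_profile : profile D 0 = 0 ->
  (forall t, 0 < t -> profile D t = 0) -> einstein g.
Proof.
move=> p0 pt; have [_ us sol] := soliton.
have u0 : u = cst 0.
  apply/funext => x; have [Ox|nOx] := pselect (Defs.orbit D x).
    by rewrite (profile_orbit Ox).
  have [t [p [t0 ->]]] := (tube_image D x).1 nOx.
  by rewrite (profile_tube D)// pt.
exists (- (eps / 2)) => c y Sc cy.
have := sol c y Sc cy.
have -> : hessian (gram g c) (u \o par c) y = 0.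
  have -> : u \o par c = cst 0 by apply/funext => z; rewrite u0.
  have partial0 i : partial i (cst 0 : 'rV[R]_n.+1 -> R) = cst 0.
    by apply/funext => z; exact: derive_cst.
  apply/matrixP => i j; rewrite !mxE !partial0 big1 ?subr0// => l _.
  by rewrite partial0 mulr0.
by rewrite addr0 scaleNr => /eqP; rewrite addr_eq0 => /eqP.
Qed.

End TracedRiccati.

Theorem proposition1p18 (R : realType) (n k : nat) (M P : topologicalType)
    (SM : smooth_manifold R n.+1 M) (SP : smooth_manifold R n P)
    (g : metric SM) (u : M -> R) (eps : R)
    (soliton : expanding_soliton g u eps)
    (complete : complete_metric g)
    (non_einstein : ~ einstein g)
    (D : cohomogeneity_one k SP g u)
    (normalized : profile D 0 = 0)
    (C : R) (law : conservation_law D eps C)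
    (t1 lam0 : R)
    (t1_large : 2 * Num.sqrt (5 / eps) < t1)
    (lam0_gt0 : 0 < lam0)
    (trL_bound : forall t, t1 <= t -> mean_curv D t <= lam0) :
  let a := lam0 + Num.sqrt (- C) in
  let du := derive1 (profile D) in
  let ddu := derive1n 2 (profile D) in
  forall t, t1 <= t ->
    ((forall p c, atlas SM c -> cdom c (tube D t p) ->
        grad_norm g u c (tube D t p) = - du t) /\
     9 / 10 * (- du t1 / (eps / 2 * t1 + a)) * (eps / 2 * t + a) < - du t)
    /\
    ((forall p c, atlas SM c -> cdom c (tube D t p) ->
        let ddt := velocity c (fun s => tube D s p) t in
        ddu t + eps / 2 = - ricci_at g c (tube D t p) ddt ddt) /\
     ddu t + eps / 2
       <= eps / 2 * (1 + 9 / 10 * (du t1 / (eps / 2 * t1 + a)))).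
Proof.
move=> a du ddu t t1t.
have [eps0 us _] := soliton.
have [p0 _] := principal_nonempty D.
have [c0 [c' [Sc' Sc0 pr c'p0]]] := product_coords D p0.
pose h := eps / 2; have h0 : 0 < h by rewrite divr_gt0.
have epsE : eps = 2 * h by rewrite /h; field.
pose y s := - du s.
pose E s := - C - eps * profile D s.
pose xi s := y s + mean_curv D s.
have [Q QP] := traced_riccati D soliton.
have dphi (s : R) : 0 < s -> is_derive s 1 (profile D) (du s).
  move=> s0; have H := is_derive_profile us Sc0 pr c'p0 s0.
  by apply: (is_derive_eq H); rewrite /du derive1E derive_val.
have ddphi (s : R) : 0 < s -> is_derive s 1 du (ddu s).
  move=> s0; have H := is_derive_profile2 us Sc0 pr c'p0 s0.
  by apply: (is_derive_eq H); rewrite /ddu derive1nS derive1n1 derive1E derive_val.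
have dy (s : R) : 0 < s -> is_derive s 1 y (E s - xi s * y s).
  move=> s0; apply: (is_derive_eq (is_derive1N (ddphi s s0))).
  by have := law s s0; rewrite -/(du s) -/(ddu s) /E /xi /y; lra.
have dE (s : R) : 0 < s -> is_derive s 1 E (2 * h * y s).
  move=> s0; have H := is_derive1B (is_derive_cst (- C : R) s 1)
    (is_derive1M (is_derive_cst (eps : R) s 1) (dphi s s0)).
  by apply: (is_derive_eq H); rewrite /= /y -epsE; ring.
have dxi (s : R) : 0 < s -> is_derive s 1 xi (h - Q s).
  move=> s0; have [dT _ _] := QP s s0.
  by apply: (is_derive_eq (is_derive1D (is_derive1N (ddphi s s0)) dT)); rewrite -/(ddu s) /h; ring.
have Q0 (s : R) : 0 < s -> 0 <= Q s by move=> /QP[].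
have QT (s : R) : 0 < s -> (xi s - y s) ^+ 2 <= n.+1%:R * Q s.
  by move=> /QP[_ _]; rewrite /xi [y s + _]addrC addrK.
have y_lim : y s @[s --> 0^'+] --> 0.
  by rewrite -[X in _ --> X]oppr0; apply: cvgN; exact: profile_derivative_lim us normalized.
have E_lim : E s @[s --> 0^'+] --> - C.
  rewrite -[X in _ --> X]subr0 -[X in _ --> _ - X](mulr0 eps).
  apply: cvgB; first exact: cvg_cst.
  by apply: cvgM; [exact: cvg_cst|exact: profile_lim us normalized].
have N0 : 0 <= n.+1%:R :> R by exact: ler0n.
have C0 : 0 < - C.
  rewrite lt_neqAle (E0_ge0 h0 N0 dy dE dxi Q0 QT y_lim E_lim) andbT.
  apply/eqP => C0; apply: non_einstein.
  apply: (einstein_of_zero_profile soliton (D := D)) => // s s0.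
  have := linear_zero h0 dy dE dxi Q0 y_lim E_lim (esym C0) s0.
  by rewrite /E -C0 sub0r => /eqP; rewrite oppr_eq0 mulf_eq0 gt_eqF//= => /eqP.
have pos (s : R) : 0 < s -> 0 < y s.
  by move=> s0; have [] := E_y_pos h0 dy dE dxi Q0 y_lim E_lim C0 s0.
have t10 : 0 < t1 by apply: le_lt_trans t1_large; rewrite mulr_ge0// sqrtr_ge0.
have t0 : 0 < t by exact: lt_le_trans t1t.
pose w s := h * s + a.
have a0 : 0 < a by rewrite ltr_wpDr// sqrtr_ge0.
have w0 s : 0 < s -> 0 < w s by move=> s0; rewrite addr_gt0// mulr_gt0.
(* [w] dominates both [xi], by the bound on [tr L], and the line [h * s] *)
have logd s : t1 <= s -> h * y s <= w s * (E s - xi s * y s).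
  move=> t1s; have s0 := lt_le_trans t10 t1s.
  apply: (log_derivative_ge h0 dy dE dxi Q0 y_lim E_lim C0 s0).
    by rewrite lerDl ltW.
  have := y_le_affine h0 N0 dy dE dxi Q0 QT y_lim E_lim C0 s0.
  by have := trL_bound s t1s; rewrite /xi /w /a; lra.
have wd (s : R) : is_derive s 1 w h by exact: is_derive1_affine.
have ratio : y t1 / w t1 <= y t / w t.
  pose dr s := (E s - xi s * y s) * (w s)^-1 + y s * (- h / w s ^+ 2).
  apply: (@le_of_derive_ge0 _ (fun s => y s / w s) dr) => // s /andP[t1s _].
    have s0 := lt_le_trans t10 t1s.
    by apply: (is_derive1M (dy s s0)); apply: is_derive1V => //; rewrite gt_eqF ?w0.
  have s0 := lt_le_trans t10 t1s; have ws := w0 s s0.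
  have -> : dr s = (w s * (E s - xi s * y s) - h * y s) / w s ^+ 2.
    by rewrite /dr; field; rewrite gt_eqF.
  by rewrite divr_ge0 ?sqr_ge0// subr_ge0 logd.
have wt := w0 t t0; have wt1 := w0 t1 t10.
have r0 : 0 < y t1 / w t1 by rewrite divr_gt0// pos.
have ddyE : - ddu t = E t - xi t * y t.
  by have := law t t0; rewrite -/(du t) -/(ddu t) /E /xi /y; lra.
split; split.
- by move=> p c Sc cx; rewrite (grad_norm_tube us Sc)// ltr0_norm// -oppr_gt0; exact: pos.
- rewrite -/h -/(w t1) -/(w t) -/(y t1) -/(y t).
  have : y t1 / w t1 * w t <= y t by rewrite -ler_pdivlMr.
  have : 0 < y t1 / w t1 * w t by rewrite mulr_gt0.
  lra.
- by move=> p c Sc cx ddt; exact: (ricci_tube us Sc soliton t0 cx).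
- rewrite -/h -/(w t1).
  have : h * (y t / w t) <= - ddu t.
    by rewrite mulrA ler_pdivrMr// ddyE [leRHS]mulrC logd.
  have : h * (y t1 / w t1) <= h * (y t / w t) by rewrite ler_pM2l.
  have : 0 < h * (y t1 / w t1) by rewrite mulr_gt0.
  rewrite (_ : du t1 / w t1 = - (y t1 / w t1)); last by rewrite /y mulNr opprK.
  lra.
Qed.
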